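(* Let $\Omega\subset\mathbb{R}^n$ be a bounded domain with smooth boundary and let $\mathcal H=H_0^1(\Omega)\times L^2(\Omega)$. Let $(u_0,u_1)\in\mathcal H$ and let $U(t)=(u(t),u_t(t))$ be the (strong) solution of $$\begin{cases} u_{tt}-\Delta u-\|\nabla u_t\|_{L^2(\Omega)}^2\,\Delta u_t=0 & \text{in }\Omega\times(0,\infty),\\ u=0 & \text{on }\partial\Omega\times(0,\infty),\\ u(0)=u_0,\quad u_t(0)=u_1 & \text{in }\Omega. \end{cases}$$ Then there exists $C>0$ such that the energy $$E(t)=\frac12\left(\|\nabla u(t)\|_{L^2(\Omega)}^2+\|u_t(t)\|_{L^2(\Omega)}^2\right)$$ satisfies $$E(t)\le \frac{C}{1+t},\qquad t\ge 0 .$$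
   Context: $\mathcal H$ carries the norm $\|(u,v)\|_{\mathcal H}^2=\|\nabla u\|_{L^2(\Omega)}^2+\|v\|_{L^2(\Omega)}^2$. With $U=(u,v)$, $v=u_t$, the problem is written $U'(t)+\mathcal A(U(t))=0$, $U(0)=(u_0,u_1)$, where $$\mathcal A(u,v)=\left(-v,\;-\Delta u-\|\nabla v\|_{L^2(\Omega)}^2\Delta v\right),\qquad D(\mathcal A)=\left(H^2(\Omega)\cap H_0^1(\Omega)\right)\times\left(H^2(\Omega)\cap H_0^1(\Omega)\right).$$ A strong solution is a continuous function $U:[0,\infty)\to\mathcal H$ with $U(0)=(u_0,u_1)$, absolutely continuous on compact subintervals of $(0,\infty)$, with $U(t)\in D(\mathcal A)$ and $U'(t)+\mathcal A(U(t))=0$ in $\mathcal H$ for a.e. $t>0$. The constant $C$ may depend on the solution (through its initial data). *)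

(* Defs.v *)
From HB Require Import structures.
From mathcomp Require Import all_boot all_order all_algebra.
From mathcomp Require Import all_classical all_reals all_analysis.

Set Implicit Arguments.
Unset Strict Implicit.
Unset Printing Implicit Defensive.
Import Order.TTheory GRing.Theory Num.Theory.
Import numFieldNormedType.Exports.
Local Open Scope classical_set_scope.
Local Open Scope ring_scope.

Definition measure_rV_display : measure_display -> measure_display.
Proof. exact. Qed.

Section measurable_rV.
Context {d} {T : sigmaRingType d} (n : nat).

Let coord : 'I_n -> 'rV[T]_n -> T := fun i x => x ord0 i.

Let rV_set0 : g_sigma_preimage coord set0.
Proof. exact: sigma_algebra0. Qed.

Let rV_setC A : g_sigma_preimage coord A -> g_sigma_preimage coord (~` A).
Proof. exact: sigma_algebraC. Qed.

Let rV_bigcup (F : _^nat) : (forall i, g_sigma_preimage coord (F i)) ->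
  g_sigma_preimage coord (\bigcup_i (F i)).
Proof. exact: sigma_algebra_bigcup. Qed.

(* The product sigma-algebra; over R, the Borel sets of R^n. *)
HB.instance Definition _ := @isMeasurable.Build (measure_rV_display d)
  'rV[T]_n (g_sigma_preimage coord) rV_set0 rV_setC rV_bigcup.

End measurable_rV.

Lemma measurable_coord d (T : sigmaRingType d) n (i : 'I_n) :
  measurable_fun [set: 'rV[T]_n] (fun x : 'rV[T]_n => x ord0 i).
Proof.
move=> _ Y mY; rewrite setTI; apply: sub_sigma_algebra => /=.
rewrite -bigcup_seq/=; exists i => /=; first by rewrite mem_index_enum.
by exists Y => //; rewrite setTI.
Qed.

Lemma measurable_fun_rV d1 d2 (T1 : measurableType d1) (T2 : sigmaRingType d2)
    n (f : T1 -> 'rV[T2]_n) :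
  (forall i, measurable_fun [set: T1] (fun x => f x ord0 i)) ->
  measurable_fun [set: T1] f.
Proof.
move=> mf.
have : g_sigma_preimage (fun i (x : 'rV[T2]_n) => x ord0 i) `<=`
    [set A | measurable (f @^-1` A)].
  apply: smallest_sub.
    split.
    - by rewrite /= preimage_set0.
    - by move=> A /= mA; rewrite setTD preimage_setC; exact: measurableC.
    - by move=> F /= mF; rewrite preimage_bigcup; exact: bigcupT_measurable.
  case: n f mf => [|n] f mf; first by rewrite big_ord0.
  rewrite -bigcup_mkord_ord; apply: bigcup_sub => i _.
  by move=> _ [B mB <-] /=; have := mf (inord i) measurableT _ mB; rewrite !setTI.
by move=> sub _ A mA; rewrite setTI; exact: sub.
Qed.

Section rV_cons.
Context {R : realType} (n : nat).

Definition rV_cons (p : measurableTypeR R * 'rV[R]_n) : 'rV[R]_n.+1 :=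
  row_mx (const_mx p.1 : 'rV[R]_1) p.2.

Lemma measurable_rV_cons :
  measurable_fun [set: measurableTypeR R * 'rV[R]_n] rV_cons.
Proof.
apply: measurable_fun_rV => i.
case: (@split_ordP 1 n i) => j ->.
  rewrite [X in measurable_fun _ X](_ : _ = fst); first exact: measurable_fst.
  by apply/funext => p; rewrite (row_mxEl (const_mx p.1 : 'rV[R]_1)) mxE.
rewrite [X in measurable_fun _ X](_ : _ =
    (fun x : 'rV[R]_n => x ord0 j) \o snd).
  exact: (measurableT_comp (measurable_coord j)).
by apply/funext => p; rewrite (row_mxEr (const_mx p.1 : 'rV[R]_1)).
Qed.

HB.instance Definition _ :=
  @isMeasurableFun.Build _ _ _ _ rV_cons measurable_rV_cons.

Definition rV_uncons (x : 'rV[R]_n.+1) : measurableTypeR R * 'rV[R]_n :=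
  (x ord0 ord0, \row_j x ord0 (lift ord0 j)).

Lemma rV_consK : cancel rV_cons rV_uncons.
Proof.
case=> a x; congr pair.
  rewrite (_ : ord0 = lshift n (ord0 : 'I_1)); last exact/val_inj.
  by rewrite (row_mxEl (const_mx a : 'rV[R]_1)) mxE.
apply/rowP => j; rewrite mxE (_ : lift ord0 j = rshift 1 j); last exact/val_inj.
by rewrite (row_mxEr (const_mx a : 'rV[R]_1)).
Qed.

Lemma measurable_rV_uncons : measurable_fun [set: 'rV[R]_n.+1] rV_uncons.
Proof.
apply: measurable_fun_pair; first exact: measurable_coord.
apply: measurable_fun_rV => j.
rewrite [X in measurable_fun _ X](_ : _ =
    (fun x : 'rV[R]_n.+1 => x ord0 (lift ord0 j))); first exact: measurable_coord.
by apply/funext => x; rewrite mxE.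
Qed.

Variable m : {sigma_finite_measure set 'rV[R]_n -> \bar R}.

Definition rV_cons_measure : set 'rV[R]_n.+1 -> \bar R :=
  pushforward (@lebesgue_measure R \x m)%E rV_cons.

Let rV_cons_measure0 : rV_cons_measure set0 = 0%E.
Proof. exact: measure0. Qed.

Let rV_cons_measure_ge0 A : (0 <= rV_cons_measure A)%E.
Proof. exact: measure_ge0. Qed.

Let rV_cons_measure_sigma_additive : semi_sigma_additive rV_cons_measure.
Proof. exact: measure_semi_sigma_additive. Qed.

HB.instance Definition _ := isMeasure.Build _ _ _ rV_cons_measure
  rV_cons_measure0 rV_cons_measure_ge0 rV_cons_measure_sigma_additive.

Let rV_cons_measure_sigma_finite : sigma_finite setT rV_cons_measure.
Proof.
have /sigma_finiteP[F [FT ndF Foo]] := sigma_finiteT (@lebesgue_measure R).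
have /sigma_finiteP[G [GT ndG Goo]] := sigma_finiteT m.
exists (fun k => rV_uncons @^-1` (F k `*` G k)).
  rewrite -preimage_bigcup (_ : \bigcup_k (F k `*` G k) = setT) ?preimage_setT//.
  rewrite -subTset => -[x y] _.
  have [i _ Fx] : (\bigcup_k F k) x by rewrite -FT.
  have [j _ Gy] : (\bigcup_k G k) y by rewrite -GT.
  exists (maxn i j) => //; split => /=.
  - by move: x Fx; exact/subsetPset/ndF/leq_maxl.
  - by move: y Gy; exact/subsetPset/ndG/leq_maxr.
move=> k; have [mFk Fkoo] := Foo k; have [mGk Gkoo] := Goo k; split.
  by rewrite -[X in measurable X]setTI; apply: measurable_rV_uncons => //;
    exact: measurableX.
rewrite /rV_cons_measure /pushforward -comp_preimage.
rewrite (_ : rV_uncons \o rV_cons = id) ?preimage_id.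
  by rewrite product_measure1E// lte_mul_pinfty// ge0_fin_numE.
by apply/funext => p; exact: rV_consK.
Qed.

HB.instance Definition _ := Measure_isSigmaFinite.Build _ _ _ rV_cons_measure
  rV_cons_measure_sigma_finite.

End rV_cons.

(* Lebesgue measure on the Borel sets of R^n, as the n-fold product of the
   Lebesgue measure on R. *)
Fixpoint lebesgue_rV {R : realType} (n : nat) :
    {sigma_finite_measure set 'rV[R]_n -> \bar R} :=
  match n with
  | 0 => [the {sigma_finite_measure set 'rV[R]_0 -> \bar R} of
            \d_(0 : 'rV[R]_0)]
  | k.+1 => [the {sigma_finite_measure set 'rV[R]_k.+1 -> \bar R} of
            rV_cons_measure (lebesgue_rV k)]
  end.

Section calculus.
Context {R : realType} {n : nat}.
Implicit Types (f u g : 'rV[R]_n -> R) (Omega : set 'rV[R]_n).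

Definition partial (i : 'I_n) f : 'rV[R]_n -> R :=
  fun x => 'D_(delta_mx 0 i) f x.

Fixpoint iter_partial (s : seq 'I_n) f : 'rV[R]_n -> R :=
  if s is i :: s' then partial i (iter_partial s' f) else f.

(* C^oo on an open set V: all iterated partial derivatives exist and are
   Frechet differentiable (hence continuous) at every point of V. *)
Definition smooth_on (V : set 'rV[R]_n) f : Prop :=
  forall s x, V x -> differentiable (iter_partial s f) x.

Definition test_function Omega f : Prop :=
  [/\ smooth_on setT f,
      compact (closure [set x | f x != 0]) &
      closure [set x | f x != 0] `<=` Omega].

Definition bounded_domain Omega : Prop :=
  [/\ Omega !=set0, open Omega, connected Omega & bounded_set Omega].

(* Near each boundary point, Omega is the sublevel set of a C^oo function
   without critical points. For open Omega, the boundary is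
   closure Omega `\` Omega. *)
Definition smooth_boundary Omega : Prop :=
  forall p, (closure Omega `\` Omega) p ->
  exists V rho, [/\ open V, V p, smooth_on V rho,
    (forall x, V x -> exists i, partial i rho x != 0) &
    (forall x, V x -> (Omega x <-> rho x < 0))].

End calculus.

(* Elements of L^2(Omega) are represented by real functions on R^n; only their
   restriction to Omega, up to a.e. equality, is relevant. *)
Section sobolev.
Context {R : realType} {n : nat} (Omega : set 'rV[R]_n).
Implicit Types (f u g : 'rV[R]_n -> R).

Local Notation mu := (@lebesgue_rV R n).

Definition L2 f : Prop := f \_ Omega \in Lfun mu 2%:E.

Definition L2norm f : R := fine ('N[mu]_2%:E[EFin \o (f \_ Omega)]).

Definition is_weak_partial (i : 'I_n) u g : Prop :=
  forall phi, test_function Omega phi ->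
    \int[mu]_(x in Omega) (u x * partial i phi x) =
    - \int[mu]_(x in Omega) (g x * phi x).

(* The weak partial derivative in L^2(Omega), unique a.e. in Omega;
   0 when there is none. *)
Definition wpartial (i : 'I_n) u : 'rV[R]_n -> R :=
  xget (cst 0) [set g | L2 g /\ is_weak_partial i u g].

Definition H1 u : Prop :=
  L2 u /\ forall i, exists g, L2 g /\ is_weak_partial i u g.

Definition H2 u : Prop := H1 u /\ forall i, H1 (wpartial i u).

Definition gradnorm u : R := Num.sqrt (\sum_(i < n) L2norm (wpartial i u) ^+ 2).

Definition H1norm u : R := Num.sqrt (L2norm u ^+ 2 + gradnorm u ^+ 2).

(* The closure of the test functions in H^1(Omega). *)
Definition H10 u : Prop :=
  H1 u /\ forall e : R, 0 < e ->
    exists2 phi, test_function Omega phi & H1norm (u - phi) < e.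

Definition laplacian u : 'rV[R]_n -> R :=
  \sum_(i < n) wpartial i (wpartial i u).

End sobolev.

Section wave.
Context {R : realType} {n : nat} (Omega : set 'rV[R]_n).

Local Notation state := (('rV[R]_n -> R) * ('rV[R]_n -> R))%type.
Implicit Types (w : state) (U : R -> state).

Definition energy_space w : Prop := H10 Omega w.1 /\ L2 Omega w.2.

Definition energy_norm w : R :=
  Num.sqrt (gradnorm Omega w.1 ^+ 2 + L2norm Omega w.2 ^+ 2).

Definition wave_domain w : Prop :=
  (H2 Omega w.1 /\ H10 Omega w.1) /\ (H2 Omega w.2 /\ H10 Omega w.2).

Definition wave_op w : state :=
  (- w.2,
   - laplacian Omega w.1 - gradnorm Omega w.2 ^+ 2 *: laplacian Omega w.2).

Definition ae_eq_on (f g : 'rV[R]_n -> R) : Prop :=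
  {ae @lebesgue_rV R n, forall x, Omega x -> f x = g x}.

Definition continuous_nonneg U : Prop :=
  forall t : R, 0 <= t ->
    energy_norm (U s - U t) @[s --> within [set s | 0 <= s] (nbhs t)] -->
    (0 : R).

Definition abs_continuous_on (a b : R) U : Prop :=
  forall e : R, 0 < e -> exists2 d : R, 0 < d &
    forall (m : nat) (s t : 'I_m -> R),
      (forall k, [/\ a <= s k, s k <= t k & t k <= b]) ->
      (forall j k, j != k -> t j <= s k \/ t k <= s j) ->
      \sum_(k < m) (t k - s k) < d ->
      \sum_(k < m) energy_norm (U (t k) - U (s k)) < e.

(* The limit of the difference quotients in the norm of the energy space. *)
Definition has_derivative_at U (t : R) w : Prop :=
  energy_norm (h^-1 *: (U (t + h) - U t) - w) @[h --> 0^'] --> (0 : R).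

(* Only the values of U on [0, +oo[ matter; U t stands for (u(t), u_t(t)), the
   first component of the equation being u' = v. The equation U' + A(U) = 0 is stated
   as: U is differentiable at t with derivative - A(U(t)). *)
Definition strong_solution (u0 u1 : 'rV[R]_n -> R) U : Prop :=
  [/\ (forall t : R, 0 <= t -> energy_space (U t)),
      continuous_nonneg U,
      ae_eq_on (U 0).1 u0 /\ ae_eq_on (U 0).2 u1,
      (forall a b : R, 0 < a -> a <= b -> abs_continuous_on a b U) &
      {ae @lebesgue_measure R, forall t : R, 0 < t ->
         wave_domain (U t) /\ has_derivative_at U t (- wave_op (U t))}].

Definition energy w : R :=
  2^-1 * (gradnorm Omega w.1 ^+ 2 + L2norm Omega w.2 ^+ 2).

End wave.

(* Main.v *)
Require Import Defs.
From HB Require Import structures.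
From mathcomp Require Import all_boot all_order all_algebra.
From mathcomp Require Import all_classical all_reals all_analysis measurable_realfun.
From mathcomp Require Import ring lra.

Set Implicit Arguments.
Unset Strict Implicit.
Unset Printing Implicit Defensive.
Import Order.TTheory GRing.Theory Num.Theory.
Import numFieldNormedType.Exports.
Local Open Scope classical_set_scope.
Local Open Scope ring_scope.

(** Write E for the energy, a = || grad u_t || and G = < u, u_t >. Testing the
    equation with u_t and with u gives, for almost every t,
    - E' = - a ^ 4,
    - G' = || u_t || ^ 2 - || grad u || ^ 2 - a ^ 2 < grad u_t, grad u >.
    So E is nonincreasing, but the dissipation sees only u_t; the term
    - || grad u || ^ 2 of G' supplies the missing coercivity. By Poincare's
    inequality || u_t || <= c a and |G| <= C E, and Young's inequality shows
    that, for a large constant K,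
    [Phi t = (1 + t) ^ 2 E t + 3 (1 + t) G t - K t]
    has a nonpositive derivative: every term which is not absorbed by
    - (1 + t) ^ 2 a ^ 4 or by - 2 (1 + t) || grad u || ^ 2 is bounded
    (decay_rate_le0). Hence (1 + t) ^ 2 E t <= C' (1 + t), which is the claim.

    Three facts make the computation legitimate.

    - A function whose increments are dominated by an absolutely continuous
      two-point function, and whose derivative is nonpositive almost everywhere,
      is nonincreasing (ac_nonincreasing). Both E and Phi have increments
      dominated by a multiple of || U t - U s || + (t - s) as long as U stays
      bounded, and their derivatives follow from the derivative of U in the
      energy norm because they are built from bounded bilinear forms
      (is_derive_bilinear).

    - The weak gradient is a choice of representative, so it is linear only
      up to null sets, and only because weak derivatives are unique: a square
      integrable function orthogonal to all test functions vanishes almost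
      everywhere (orthogonal_ae_eq0). Products of functions exp (- 1 / (k s))
      are test functions that increase to indicators of boxes, and boxes
      determine a function almost everywhere.

    - Green's identity (green_identity) and Poincare's inequality (poincare)
      hold for test functions because the integral of a partial derivative of
      a compactly supported function is zero (integral_partial_eq0), and they
      pass to the closure of the test functions. *)

(** * Monotonicity from an almost everywhere sign of the derivative *)

(** The supremum of the points reached from a with P is itself reached, and can
    be passed unless it is b. This is Cousin's lemma on tagged partitions,
    without the partitions. *)
Lemma cousin_induction (R : realType) (P : R -> Prop) (a b : R) :
  a <= b -> P a ->
  (forall x, a <= x <= b -> exists2 d : R, 0 < d &
     forall s t, a <= s -> s <= x -> x <= t -> t <= b ->
       x - s < d -> t - x < d -> P s -> P t) ->
  P b.
Proof.
move=> ab Pa step.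
pose S := [set c | a <= c <= b /\ P c].
have Sa : S a by rewrite /S /= lexx ab.
have Sb : ubound S b by move=> c [/andP[]].
have hS : has_sup S by split; [exists a|exists b].
have aS : a <= sup S := sup_upper_bound hS Sa.
have Sle : sup S <= b by apply: ge_sup; [exists a|exact: Sb].
have [d d0 H] := step (sup S) (introT andP (conj aS Sle)).
have [s [/andP[as_ sb] Ps] xs] := sup_adherent d0 hS.
have sS : s <= sup S by apply: (sup_upper_bound hS); split=> //; rewrite as_.
have Pt t : sup S <= t -> t <= b -> t - sup S < d -> P t.
  by move=> St tb td; apply: (H s) => //; lra.
have [Sb'|bS] := ltP (sup S) b; last by apply: Pt => //; lra.
have [dS|Sd] := leP (b - sup S) (d / 2); first by apply: Pt; lra.
have : S (sup S + d / 2).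
  by split; [apply/andP; split; lra|apply: Pt; lra].
by move=> /(sup_upper_bound hS); lra.
Qed.

(** Cover the null set of bad times by an open set V of small measure. Near a
    good time F increases by at most e (t - s); a step near a bad time can be
    taken inside V, and all such steps together have small total length, so that
    absolute continuity bounds their total contribution. *)
Lemma ac_nonincreasing (R : realType) (F : R -> R) (D : R -> R -> R) (a b : R) :
  a <= b ->
  (forall e : R, 0 < e -> exists2 d : R, 0 < d &
    forall (m : nat) (s t : 'I_m -> R),
      (forall k, [/\ a <= s k, s k <= t k & t k <= b]) ->
      (forall j k, j != k -> t j <= s k \/ t k <= s j) ->
      \sum_(k < m) (t k - s k) < d ->
      \sum_(k < m) D (s k) (t k) < e) ->
  (forall s t, a <= s -> s <= t -> t <= b -> F t - F s <= D s t) ->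
  {ae @lebesgue_measure R, forall t : R, a <= t <= b ->
     exists2 l, l <= 0 & is_derive t (1 : R) F l} ->
  F b <= F a.
Proof.
move=> ab acD FD [N [mN N0 subN]].
have good x : a <= x <= b -> ~ N x -> forall e : R, 0 < e ->
    exists2 d : R, 0 < d & forall s t, s <= x -> x <= t ->
      x - s < d -> t - x < d -> F t - F s <= e * (t - s).
  move=> xab Nx e e0.
  have [l l0 [Fx Fl]] : exists2 l, l <= 0 & is_derive x (1 : R) F l.
    apply: contrapT => h; apply: Nx; apply: subN => /=; apply: contra_not h.
    exact.
  have : h^-1 *: ((F \o shift x) (h *: (1 : R)) - F x) @[h --> 0^'] --> l.
    by rewrite -Fl; exact: Fx.
  move=> /cvgrPdist_lt/(_ e e0) /= [d /= d0 H].
  have {}H h : h != 0 -> `|h| < d ->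
      `|l - h^-1 * (F (h + x) - F x)| < e.
    move=> h0 hd; have := H h _ h0; rewrite /ball_ /= sub0r normrN => /(_ hd).
    by rewrite /= /shift /= -[h *: 1]/(h * 1) mulr1.
  exists d => // s t sx xt xsd txd.
  have Ht : F t - F x <= e * (t - x).
    have [->|tx] := eqVneq t x; first lra.
    have tx0 : 0 < t - x by rewrite subr_gt0 lt_neqAle eq_sym tx.
    have := H (t - x) (lt0r_neq0 tx0); rewrite gtr0_norm// => /(_ txd).
    rewrite subrK ltr_norml => /andP[+ _].
    move=> h; have : (t - x)^-1 * (F t - F x) <= e by lra.
    by rewrite ler_pdivrMl// mulrC.
  have Hx : F x - F s <= e * (x - s).
    have [->|sx'] := eqVneq s x; first lra.
    have tx0 : s - x < 0 by rewrite subr_lt0 lt_neqAle sx' sx.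
    have := H (s - x) (ltr0_neq0 tx0); rewrite ltr0_norm// opprB => /(_ xsd).
    rewrite subrK ltr_norml => /andP[+ _].
    move=> h; have : (s - x)^-1 * (F s - F x) <= e by lra.
    rewrite ler_ndivrMl// => h'.
    lra.
  lra.
apply/ler_addgt0Pr => e' e'0.
pose e := e' / (b - a + 1).
have ba1 : 0 < b - a + 1 by lra.
have e0 : 0 < e by rewrite divr_gt0.
have [d d0 Hd] := acD e e0.
have N0' : (@lebesgue_measure R N < +oo)%E by rewrite N0.
have [V [oV NV mV]] := lebesgue_regularity_outer mN N0' d0.
have mV' : measurable V by exact: open_measurable.
have {}mV : (@lebesgue_measure R V < d%:E)%E.
  apply: le_lt_trans mV; rewrite (measureDI lebesgue_measure mV' mN).
  rewrite [X in (_ + X <= _)%E](_ : _ = 0%E) ?adde0//; last first.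
    apply/eqP; rewrite eq_le measure_ge0 andbT -N0.
    by apply: le_measure; rewrite ?inE//; exact: measurableI.
(* Up to time c, F grows by at most e (c - a) plus its growth on a list of
   nonoverlapping intervals whose total length is at most the measure of the
   part of V before c; the latest interval comes first. *)
pose P c := exists l : seq (R * R),
  [/\ all (fun p => (a <= p.1) && (p.1 <= p.2) && (p.2 <= c)) l,
      pairwise (fun p q => q.2 <= p.1) l,
      ((\sum_(p <- l) (p.2 - p.1))%:E <=
        @lebesgue_measure R (V `&` `[a, c]%classic))%E &
      F c - F a <= e * (c - a) + \sum_(p <- l) D p.1 p.2].
have : P b.
  apply: (@cousin_induction _ _ a) => //.
    by exists [::]; split; rewrite //= ?big_nil ?measure_ge0//; lra.
  move=> x xab; have [Nx|Nx] := pselect (N x).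
    have : nbhs x V by apply: open_nbhs_nbhs; split => //; exact: NV.
    move=> [dl /= dl0 bV]; exists dl => // s t as_ sx xt tb xs tx.
    move=> [l [l1 l2 l3 l4]].
    exists ((s, t) :: l); split => /=.
    - rewrite as_ (le_trans sx xt) lexx/=; apply: sub_all l1 => p /andP[-> /= h].
      by rewrite (le_trans h) // (le_trans sx).
    - rewrite l2 andbT; apply: sub_all l1 => p /andP[_ /=]; exact.
    - rewrite big_cons /= EFinD addrC -/((_ + _)%E).
      have -> : V `&` `[a, t]%classic =
          (V `&` `[a, s]%classic) `|` `]s, t]%classic.
        apply/seteqP; split => y /=; rewrite !in_itv /=.
          move=> [Vy /andP[ay yt]]; have [ys|sy] := leP y s.
            by left; rewrite ay.
          by right; rewrite yt.
        move=> [[Vy /andP[ay ys]]|/andP[sy yt]].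
          by rewrite ay; split => //; rewrite (le_trans ys)// (le_trans sx).
        split; last by rewrite (le_trans as_ (ltW sy)).
        by apply: bV; rewrite /ball_ /= ltr_norml; apply/andP; split; lra.
      rewrite measureU//=; last 2 first.
      + by apply: measurableI.
      + apply/seteqP; split => // y /=; rewrite !in_itv /=.
        by move=> [[_ /andP[_ +]] /andP[]]; lra.
      apply: leeD => //; rewrite lebesgue_measure_itv/= lte_fin.
      by case: ltP => // ts; rewrite lee_fin; lra.
    - rewrite big_cons /=; have := FD s t as_ (le_trans sx xt) tb.
      have : 0 <= e * (t - s) by rewrite mulr_ge0//; lra.
      lra.
  have [dl dl0 H] := good x xab Nx e e0.
  exists dl => // s t as_ sx xt tb xs tx [l [l1 l2 l3 l4]].
  exists l; split => //.
  - apply: sub_all l1 => p /andP[-> /= h].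
    by rewrite (le_trans h) // (le_trans sx).
  - apply: (le_trans l3); apply: le_measure; rewrite ?inE//=.
    + exact: measurableI.
    + exact: measurableI.
    + apply: setIS => y /=; rewrite !in_itv /= => /andP[-> /= ys].
      by rewrite (le_trans ys)// (le_trans sx).
  - have := H s t sx xt xs tx; lra.
move=> [l [l1 l2 l3 l4]].
have : \sum_(p <- l) D p.1 p.2 < e.
  rewrite (big_nth (0, 0)) big_mkord; apply: Hd.
  - move=> k; have /= := elimT (all_nthP (0,0)) l1 k (ltn_ord k).
    by move=> /andP[/andP[-> ->] ->].
  - move=> j k jk.
    have l2' := elimT (pairwiseP (0, 0)) l2.
    have [jk'|kj|jk'] := ltngtP j k;
      last by move/val_inj: jk' jk => ->; rewrite eqxx.
    + by right; apply: l2' => //; rewrite inE.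
    + by left; apply: l2' => //; rewrite inE.
  - rewrite -(big_mkord xpredT (fun i => (nth (0,0) l i).2 - (nth (0,0) l i).1)).
    rewrite -(big_nth (0,0) xpredT (fun p => p.2 - p.1)) -lte_fin.
    apply: (le_lt_trans l3); apply: le_lt_trans mV.
    by apply: le_measure; rewrite ?inE//=; exact: measurableI.
have : e * (b - a + 1) = e' by rewrite /e divfK// gt_eqF.
lra.
Qed.

(** * Bilinear forms on subspaces *)

Section bilinear.
Context {R : realType} {V : lmodType R}.
Implicit Types (P : set V) (B : V -> V -> R) (x y z : V).

(** Closure under the operations is a predicate rather than a substructure,
    because the spaces below consist of representatives of classes of functions
    inside the space of all functions. *)
Definition subspace P := P 0 /\ forall (a : R) x y, P x -> P y -> P (a *: x + y).

Record bilinear_on P B : Prop := BilinearOn {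
  bil_domain : subspace P;
  bilDl : forall x y z, P x -> P y -> P z -> B (x + y) z = B x z + B y z;
  bilDr : forall x y z, P x -> P y -> P z -> B x (y + z) = B x y + B x z;
  bilZl : forall (a : R) x y, P x -> P y -> B (a *: x) y = a * B x y;
  bilZr : forall (a : R) x y, P x -> P y -> B x (a *: y) = a * B x y }.

(** No definiteness: a nonzero function may vanish almost everywhere. *)
Record semi_inner_on P B : Prop := SemiInnerOn {
  sip_bilinear : bilinear_on P B;
  sipC : forall x y, P x -> P y -> B x y = B y x;
  sip_ge0 : forall x, P x -> 0 <= B x x }.

Lemma semi_inner_of_left P B : subspace P ->
  (forall x y, P x -> P y -> B x y = B y x) ->
  (forall (a : R) x y z, P x -> P y -> P z ->
    B (a *: x + y) z = a * B x z + B y z) ->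
  (forall x, P x -> 0 <= B x x) -> semi_inner_on P B.
Proof.
move=> sP BC Bl B0; have [P0 sP'] := sP.
have BDl x y z : P x -> P y -> P z -> B (x + y) z = B x z + B y z.
  by move=> Px Py Pz; rewrite -[x]scale1r Bl// scale1r mul1r.
have B0l z : P z -> B 0 z = 0.
  move=> Pz; have := BDl 0 0 z P0 P0 Pz; rewrite addr0; lra.
have BZl (a : R) x z : P x -> P z -> B (a *: x) z = a * B x z.
  by move=> Px Pz; rewrite -[_ *: _]addr0 Bl// B0l// addr0.
have PD x y : P x -> P y -> P (x + y).
  by move=> Px Py; rewrite -[x]scale1r; exact: sP'.
have PZ (a : R) x : P x -> P (a *: x).
  by move=> Px; rewrite -[_ *: _]addr0; exact: sP'.
split => //; split => //.
- by move=> x y z Px Py Pz; rewrite !(BC x)// ?BDl//; exact: PD.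
- by move=> a x y Px Py; rewrite !(BC x)// ?BZl//; exact: PZ.
Qed.

Lemma subspaceD P x y : subspace P -> P x -> P y -> P (x + y).
Proof. by move=> [_ sP] Px Py; rewrite -[x]scale1r; exact: sP. Qed.

Lemma subspaceZ P (a : R) x : subspace P -> P x -> P (a *: x).
Proof. by move=> [P0 sP] Px; rewrite -[_ *: _]addr0; exact: sP. Qed.

Lemma subspaceN P x : subspace P -> P x -> P (- x).
Proof. by move=> sP Px; rewrite -scaleN1r; exact: subspaceZ. Qed.

Lemma subspaceB P x y : subspace P -> P x -> P y -> P (x - y).
Proof. by move=> sP Px Py; apply: subspaceD => //; exact: subspaceN. Qed.

Lemma bilNl P B x y : bilinear_on P B -> P x -> P y -> B (- x) y = - B x y.
Proof. by move=> bB Px Py; rewrite -scaleN1r (bilZl bB)// mulN1r. Qed.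

Lemma bilNr P B x y : bilinear_on P B -> P x -> P y -> B x (- y) = - B x y.
Proof. by move=> bB Px Py; rewrite -scaleN1r (bilZr bB)// mulN1r. Qed.

Section semi_inner_theory.
Variables (P : set V) (B : V -> V -> R) (sB : semi_inner_on P B).
Let bB := sip_bilinear sB.
Let sP := bil_domain bB.

Lemma sip_sqr_axpy (a : R) x y : P x -> P y ->
  B (a *: x + y) (a *: x + y) = a ^+ 2 * B x x + 2 * a * B x y + B y y.
Proof.
move=> Px Py; have Pax : P (a *: x) by exact: subspaceZ.
rewrite (bilDl bB) ?(bilDr bB) ?(bilZl bB) ?(bilZr bB)//; last first.
  exact: subspaceD.
rewrite (sipC sB Py Px); ring.
Qed.

(** The discriminant argument; when B x x = 0 there is no minimum to evaluate,
    and the affine function of a that remains must be constant. *)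
Lemma sip_cauchy_schwarz x y : P x -> P y ->
  `|B x y| <= Num.sqrt (B x x) * Num.sqrt (B y y).
Proof.
move=> Px Py.
have quad a : 0 <= a ^+ 2 * B x x + 2 * a * B x y + B y y.
  rewrite -sip_sqr_axpy//; apply: (sip_ge0 sB).
  by apply: subspaceD => //; exact: subspaceZ.
have xx0 := sip_ge0 sB Px; have yy0 := sip_ge0 sB Py.
rewrite -sqrtrM// -sqrtr_sqr ler_sqrt ?mulr_ge0//.
have [x0|x0] := eqVneq (B x x) 0.
  rewrite x0 mul0r.
  suff -> : B x y = 0 by rewrite expr0n.
  apply/eqP; apply: contraT => xy0.
  have := quad (- (B y y + 1) / (2 * B x y)); rewrite x0 mulr0 add0r.
  have -> : 2 * (- (B y y + 1) / (2 * B x y)) * B x y = - (B y y + 1).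
    by field.
  lra.
have xxgt0 : 0 < B x x by rewrite lt_neqAle eq_sym x0.
have := quad (- B x y / B x x).
have -> : (- B x y / B x x) ^+ 2 * B x x + 2 * (- B x y / B x x) * B x y + B y y =
   (B x x * B y y - B x y ^+ 2) / B x x by field.
by rewrite ler_pdivlMr// mul0r subr_ge0.
Qed.

Lemma sip_triangle x y : P x -> P y ->
  Num.sqrt (B (x + y) (x + y)) <= Num.sqrt (B x x) + Num.sqrt (B y y).
Proof.
move=> Px Py; rewrite -[leRHS]ger0_norm ?addr_ge0 ?sqrtr_ge0// -sqrtr_sqr.
rewrite ler_sqrt ?sqr_ge0// -[x in B (x + _)]scale1r -[x in B _ (x + _)]scale1r.
rewrite sip_sqr_axpy// sqrrD !sqr_sqrtr ?(sip_ge0 sB)//.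
have := ler_norml (B x y) (Num.sqrt (B x x) * Num.sqrt (B y y)).
rewrite sip_cauchy_schwarz// => /esym/andP[_]; lra.
Qed.

End semi_inner_theory.

(** With U (t + h) = U t + h (W + w h) and N (w h) tending to 0, the difference
    quotient of B (U s) (U s) differs from the stated value by
    B (w h) (U t) + B (U t) (w h) + h B (W + w h) (W + w h). *)
Lemma is_derive_bilinear P B (N : V -> R) (c : R) (U : R -> V) (W : V) (t : R) :
  bilinear_on P B -> 0 <= c -> (forall x, P x -> 0 <= N x) ->
  (forall x y, P x -> P y -> `|B x y| <= c * (N x * N y)) ->
  (\forall h \near (0 : R), P (U (t + h))) -> P W ->
  N (h^-1 *: (U (t + h) - U t) - W) @[h --> 0^'] --> (0 : R) ->
  is_derive t (1 : R) (fun s => B (U s) (U s)) (B W (U t) + B (U t) W).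
Proof.
move=> bB c0 N0 BN PU PW dU; have sP := bil_domain bB.
have PUt : P (U t) by have := nbhs_singleton PU; rewrite addr0.
set L := B W (U t) + B (U t) W.
have [w wE dw] : exists2 w : R -> V,
    (forall h, w h = h^-1 *: (U (t + h) - U t) - W) &
    N (w h) @[h --> 0^'] --> (0 : R).
  by exists (fun h => h^-1 *: (U (t + h) - U t) - W).
suff cv : h^-1 *: (((fun s => B (U s) (U s)) \o shift t) (h *: (1 : R)) -
    B (U t) (U t)) @[h --> 0^'] --> L.
  by apply: DeriveDef; [apply/cvg_ex; exists L|exact/cvg_lim].
pose r h := (2 * c * N (U t)) * N (w h) +
  `|h| * (c * ((N W + N (w h)) * (N W + N (w h)))).
have r0 : r h @[h --> 0^'] --> (0 : R).
  have e : 2 * c * N (U t) * 0 + `|0 : R| * (c * ((N W + 0) * (N W + 0))) = 0.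
    by rewrite normr0 mulr0 mul0r addr0.
  rewrite -[X in _ --> X]e.
  apply: cvgD; first exact: cvgMr.
  apply: cvgM.
    by apply: cvg_norm; apply: cvg_within_filter; exact: cvg_id.
  by apply: cvgMr; apply: cvgM; apply: cvgD => //; exact: cvg_cst.
apply/subr_cvg0; apply: (@squeeze_cvgr _ _ _ _ (fun h => - r h) r) => //; last first.
  by rewrite -[X in _ --> X]oppr0; exact: cvgN.
have PU' : \forall h \near (0 : R)^', P (U (t + h)) by exact: cvg_within.
have nz : \forall h \near (0 : R)^', h != 0 by exact: nbhs_dnbhs_neq.
near=> h; rewrite -ler_norml.
have h0 : h != 0 by near: h.
have Pth : P (U (t + h)) by near: h.
have Pw : P (w h).
  by rewrite wE; apply: subspaceB => //; apply: subspaceZ => //; exact: subspaceB.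
have PWw : P (W + w h) by exact: subspaceD.
have Uh : U (h *: (1 : R) + t) = h *: (W + w h) + U t.
  rewrite -[h *: 1]/(h * 1) mulr1 wE addrCA subrr addr0 scalerA divff// scale1r.
  by rewrite subrK addrC.
have Phw : P (h *: (W + w h)) by exact: subspaceZ.
rewrite /= /shift Uh.
rewrite (bilDl bB)// ?(bilDr bB) ?(bilZl bB) ?(bilZr bB)//; last exact: subspaceD.
have -> : h^-1 *: (h * (h * B (W + w h) (W + w h)) + h * B (W + w h) (U t) +
    (h * B (U t) (W + w h) + B (U t) (U t)) - B (U t) (U t)) - L =
   h * B (W + w h) (W + w h) + B (w h) (U t) + B (U t) (w h).
  rewrite /L [X in _ + h * X + _](bilDl bB)// [X in _ + (h * X + _)](bilDr bB)//.
  by rewrite -[_ *: _]/(_ * _); field.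
have NWw : 0 <= N W + N (w h) by rewrite addr_ge0 ?N0.
have Bsq : `|B (W + w h) (W + w h)| <=
    c * ((N W + N (w h)) * (N W + N (w h))).
  rewrite (bilDl bB)// !(bilDr bB)//.
  have := BN _ _ PW PW; have := BN _ _ Pw Pw.
  have := BN _ _ PW Pw; have := BN _ _ Pw PW.
  set a1 := B _ _; set a2 := B _ _; set a3 := B _ _; set a4 := B _ _.
  have := ler_normD (a4 + a2) (a1 + a3).
  have := ler_normD a4 a2; have := ler_normD a1 a3.
  lra.
have := BN _ _ Pw PUt; have := BN _ _ PUt Pw => B1 B2.
have := ler_wpM2l (normr_ge0 h) Bsq; rewrite -normrM => B3.
apply: (le_trans (ler_normD _ _)); rewrite /r.
have := ler_normD (h * B (W + w h) (W + w h)) (B (w h) (U t)).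
lra.
Unshelve. all: by end_near.
Qed.

(** B x x - B y y = B x (x - y) + B (x - y) y. *)
Lemma bilinear_quadratic_lipschitz P B (N : V -> R) (c : R) x y :
  bilinear_on P B ->
  (forall x y, P x -> P y -> `|B x y| <= c * (N x * N y)) ->
  P x -> P y ->
  `|B x x - B y y| <= c * (N x + N y) * N (x - y).
Proof.
move=> bB BN Px Py; have sP := bil_domain bB.
have Pxy : P (x - y) by exact: subspaceB.
have -> : B x x - B y y = B x (x - y) + B (x - y) y.
  rewrite (bilDr bB) ?(bilDl bB) ?(bilNl bB) ?(bilNr bB)//; first ring.
  - exact: subspaceN.
  - exact: subspaceN.
apply: (le_trans (ler_normD _ _)).
have := BN _ _ Px Pxy; have := BN _ _ Pxy Py; lra.
Qed.

End bilinear.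

(** * Cubes, open sets and translations in Euclidean space *)

Section euclidean_cubes.
Context {R : realType} {n : nat}.
Implicit Types (c x : 'rV[R]_n) (r : R).

Definition cube c r : set 'rV[R]_n := [set x | forall i, `|x 0 i - c 0 i| < r].

Definition closed_cube c r : set 'rV[R]_n :=
  [set x | forall i, `|x 0 i - c 0 i| <= r].

Lemma ball_cube c r : 0 < r -> ball c r = cube c r.
Proof.
move=> r0; apply/seteqP; split => x /=.
  move=> [_ bx] i; have := bx 0 i; rewrite /ball /= distrC; exact.
move=> cx; split => // i j; rewrite (ord1 i) /ball /= distrC; exact: cx.
Qed.

Lemma measurable_coord_preimage (i : 'I_n) (Y : set R) :
  measurable Y -> measurable [set x : 'rV[R]_n | Y (x 0 i)].
Proof.
move=> mY; rewrite -[X in measurable X]setTI.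
exact: (@measurable_coord _ R n i measurableT Y mY).
Qed.

Lemma measurable_coords (Y : 'I_n -> set R) :
  (forall i, measurable (Y i)) ->
  measurable [set x : 'rV[R]_n | forall i, Y i (x 0 i)].
Proof.
move=> mY.
have -> : [set x : 'rV[R]_n | forall i, Y i (x 0 i)] =
    \bigcap_(i in [set: 'I_n]) [set x | Y i (x 0 i)].
  by apply/seteqP; split => x /= h; [move=> i _; exact: h|move=> i; exact: (h i I)].
by apply: fin_bigcap_measurable => // i _; exact: measurable_coord_preimage.
Qed.

Lemma cubeE c r : cube c r =
  [set x | forall i, (`](c 0 i - r), (c 0 i + r)[%classic : set R) (x 0 i)].
Proof.
by apply/seteqP; split => x /= h i; have := h i;
  rewrite in_itv /= ltr_distl.
Qed.

Lemma closed_cubeE c r : closed_cube c r =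
  [set x | forall i, (`[(c 0 i - r), (c 0 i + r)]%classic : set R) (x 0 i)].
Proof.
by apply/seteqP; split => x /= h i; have := h i;
  rewrite in_itv /= ler_distl.
Qed.

Lemma measurable_cube c r : measurable (cube c r).
Proof.
rewrite cubeE.
exact: (@measurable_coords (fun i => `](c 0 i - r), (c 0 i + r)[%classic)).
Qed.

Lemma measurable_closed_cube c r : measurable (closed_cube c r).
Proof.
rewrite closed_cubeE.
exact: (@measurable_coords (fun i => `[(c 0 i - r), (c 0 i + r)]%classic)).
Qed.

Lemma closed_cube_compact c r : compact (closed_cube c r).
Proof.
rewrite closed_cubeE.
exact: (@rV_compact R n (fun i => `[(c 0 i - r), (c 0 i + r)]%classic)
  (fun i => @segment_compact R _ _)).
Qed.

Lemma closed_cube_closed c r : closed (closed_cube c r).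
Proof.
exact: (@compact_closed _ _ (@norm_hausdorff _ _) (@closed_cube_compact c r)).
Qed.

Lemma subset_cube_closed_cube c r : cube c r `<=` closed_cube c r.
Proof. by move=> x cx i; exact: ltW. Qed.

(** Cubes with rational centres and radii 1 / (k + 1). That even the closed cubes
    lie in V is what makes bump functions on them test functions for V. Indices
    that encode no such cube give the empty set. *)
Lemma open_cube_cover (V : set 'rV[R]_n) : open V ->
  exists2 C : nat -> set 'rV[R]_n, \bigcup_m C m = V &
    forall m, C m = set0 \/
      exists c r, [/\ 0 < r, C m = cube c r & closed_cube c r `<=` V].
Proof.
move=> oV.
have [rad rad0 radP] : exists2 rad : nat -> R, (forall k, 0 < rad k) &
    forall e, 0 < e -> exists k, 2 * rad k < e.
  exists (fun k => k.+1%:R^-1) => [k|e e0]; first by rewrite invr_gt0 ltr0n.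
  have [k _] := near_infty_natSinv_lt (PosNum (divr_gt0 e0 (ltr0n R 2))).
  move=> /(_ k (leqnn k)) /= h; exists k.
  by have : k.+1%:R^-1 < e / 2 := h; rewrite ltr_pdivlMr // mulrC.
pose D (p : 'rV[rat]_n * nat) : set 'rV[R]_n :=
  if pselect (closed_cube (map_mx ratr p.1) (rad p.2) `<=` V) is left _
  then cube (map_mx ratr p.1) (rad p.2) else set0.
exists (fun m => if unpickle m is Some p then D p else set0); last first.
  move=> m; case: unpickle => [p|]; last by left.
  rewrite /D; case: pselect => [h|_]; last by left.
  by right; exists (map_mx ratr p.1), (rad p.2); split.
apply/seteqP; split => x.
  move=> [m _]; case: unpickle => [p|//].
  by rewrite /D; case: pselect => // h /subset_cube_closed_cube/h.
move=> Vx; have /nbhs_ballP[e /= e0 bV] : nbhs x V by exact: open_nbhs_nbhs.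
have [k ke] := radP e e0; have k0 := rad0 k.
have qP i : exists q : rat, `|x 0 i - ratr q| < rad k :> R.
  have xk : x 0 i - rad k < x 0 i + rad k by lra.
  have [q] := rat_in_itvoo xk.
  by rewrite in_itv /= -ltr_distl => h; exists q; rewrite distrC.
have [q qx] := choice qP.
have h : closed_cube (map_mx ratr (\row_i q i)) (rad k) `<=` V.
  move=> y yq; apply: bV; rewrite ball_cube// => i.
  have := yq i; have := qx i; rewrite !mxE.
  have := ler_distD (ratr (q i)) (y 0 i) (x 0 i).
  by rewrite (distrC (ratr (q i)) (x 0 i)); lra.
exists (pickle (\row_i q i, k)) => //=; rewrite pickleK /D.
by case: pselect => // _ i /=; rewrite !mxE.
Qed.

Lemma open_measurable_rV (V : set 'rV[R]_n) : open V -> measurable V.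
Proof.
move=> /open_cube_cover[C <- CP]; apply: bigcupT_measurable => m.
case: (CP m) => [->|[c [r [_ -> _]]]]; first exact: measurable0.
exact: measurable_cube.
Qed.

Lemma continuous_measurable_rV (f : 'rV[R]_n -> R) :
  continuous f -> measurable_fun setT f.
Proof.
move=> /continuousP cf.
apply: (measurability _ (RGenOpens.measurableE R)).
move=> _ [_ [x [y ->]] <-]; rewrite setTI; apply: open_measurable_rV.
by apply: cf; exact: interval_open.
Qed.

End euclidean_cubes.

Lemma rV_consE (R : realType) n (a : R) (x : 'rV[R]_n) :
  rV_cons (a, x) 0 0 = a /\ forall j, rV_cons (a, x) 0 (lift ord0 j) = x 0 j.
Proof.
have [h1 h2] : rV_uncons (rV_cons (a, x)) = (a, x) := rV_consK (a, x).
by split=> // j; rewrite -[in RHS]h2 mxE.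
Qed.

(** The measure of a cube is a product of lengths of intervals. *)
Lemma lebesgue_rV_closed_cube_lty (R : realType) n (c : 'rV[R]_n) r :
  (lebesgue_rV n (closed_cube c r) < +oo)%E.
Proof.
elim: n c => [|n IH] c /=.
  by rewrite diracE; case: (_ \in _); rewrite ltry.
rewrite /rV_cons_measure /pushforward.
pose c' : 'rV[R]_n := \row_j c 0 (lift ord0 j).
rewrite (_ : @rV_cons R n @^-1` closed_cube c r =
    `[(c 0 0 - r), (c 0 0 + r)]%classic `*` closed_cube c' r).
  rewrite product_measure1E//; last exact: measurable_closed_cube.
  apply: lte_mul_pinfty; rewrite ?measure_ge0 ?IH//.
  set a := c 0 0 - r; set b := c 0 0 + r.
  have : (@lebesgue_measure R `[a, b]%classic < +oo)%E.
    by rewrite lebesgue_measure_itv /=; case: ifP => // _; rewrite -EFinD ltry.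
  by move=> h; rewrite ge0_fin_numE.
apply/seteqP; split => -[a x] /=.
  move=> h; split => /=.
    have := h 0; rewrite (rV_consE a x).1.
    by rewrite in_itv /= ler_distl.
  move=> j; have := h (lift ord0 j).
  by rewrite (rV_consE a x).2 mxE.
rewrite in_itv /= -ler_distl => -[h1 h2] i.
case: (unliftP ord0 i) => [j|] ->.
  by rewrite (rV_consE a x).2; have := h2 j; rewrite mxE.
by rewrite (rV_consE a x).1.
Qed.

(** Both sides are measures that agree on half-open intervals. *)
Lemma lebesgue_measure_translation (R : realType) (a : R) (A : set R) :
  measurable A -> lebesgue_measure ((fun x => x + a) @^-1` A) = lebesgue_measure A.
Proof.
move=> mA.
have mf : measurable_fun [set: measurableTypeR R]
   ((fun x => x + a) : measurableTypeR R -> measurableTypeR R).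
  exact: measurable_funD.
apply/esym; apply: (@lebesgue_measure_unique R
  (measure_function_pushforward__canonical__measure_function_Measure
     lebesgue_measure mf)) => // X.
move=> /ocitvP[->|[[x y] /= xy ->]]; first by rewrite !measure0.
rewrite /pushforward.
have -> : (fun x => x + a) @^-1` `]x, y]%classic = `]x - a, y - a]%classic.
  by apply/seteqP; split => z /=; rewrite !in_itv /=; lra.
rewrite !lebesgue_measure_itv /= !lte_fin ltrD2r; case: ifP => // _.
by rewrite -!EFinD; congr EFin; ring.
Qed.

(** Splitting off the first coordinate, the translated measure agrees with the
    product measure on rectangles, hence everywhere. *)
Lemma lebesgue_rV_translation (R : realType) n (v : 'rV[R]_n) (A : set 'rV[R]_n) :
  measurable A ->
  lebesgue_rV n ((fun x => x + v) @^-1` A) = lebesgue_rV n A.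
Proof.
elim: n v A => [|n IH] v A mA.
  by congr (lebesgue_rV 0 _); apply/seteqP; split => x /=;
    rewrite (thinmx0 v) addr0.
pose v' : 'rV[R]_n := \row_j v 0 (lift ord0 j).
pose sh (p : measurableTypeR R * 'rV[R]_n) : measurableTypeR R * 'rV[R]_n :=
  (p.1 + v 0 0, p.2 + v').
have msh : measurable_fun setT sh.
  apply: measurable_fun_pair.
    by apply: measurable_funD => //; exact: measurable_fst.
  apply: measurable_fun_rV => i.
  under eq_fun do rewrite mxE.
  apply: measurable_funD => //.
  exact: (measurableT_comp (measurable_coord i) measurable_snd).
rewrite /= /rV_cons_measure /pushforward.
have -> : @rV_cons R n @^-1` ((fun x => x + v) @^-1` A) = sh @^-1` (@rV_cons R n @^-1` A).
  have e p : rV_cons p + v = rV_cons (sh p).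
    case: p => a x; apply/rowP => i; rewrite [LHS]mxE /sh /=.
    case: (unliftP ord0 i) => [j|] ->; last by rewrite !(rV_consE _ _).1.
    by rewrite !(rV_consE _ _).2 !mxE.
  by apply/seteqP; split => p /=; rewrite e.
apply/esym; apply: (@product_measure_unique _ _ _ _ _ lebesgue_measure
  (lebesgue_rV n) (measure_function_pushforward__canonical__measure_function_Measure
     (lebesgue_measure \x lebesgue_rV n)%E msh)); last first.
  by rewrite -[X in measurable X]setTI; exact: measurable_rV_cons.
move=> A1 A2 mA1 mA2.
set B1 := (fun x : R => x + v 0 0) @^-1` A1.
set B2 := (fun x : 'rV[R]_n => x + v') @^-1` A2.
transitivity ((lebesgue_measure \x lebesgue_rV n)%E (B1 `*` B2)) => //.
have mB1 : measurable B1.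
  have : measurable_fun setT (fun x : R => x + v 0 0) by exact: measurable_funD.
  by move=> /(_ measurableT _ mA1); rewrite setTI.
have mB2 : measurable B2.
  have : measurable_fun setT (fun x : 'rV[R]_n => x + v').
    apply: measurable_fun_rV => i; under eq_fun do rewrite mxE.
    by apply: measurable_funD => //; exact: measurable_coord.
  by move=> /(_ measurableT _ mA2); rewrite setTI.
rewrite product_measure1E// IH//; congr (_ * _)%E.
exact: lebesgue_measure_translation.
Qed.

(** * Integrals of partial derivatives *)

Section bounded_support.
Context {R : realType} {n : nat}.
Local Notation mu := (@lebesgue_rV R n).
Implicit Types (f : 'rV[R]_n -> R) (c : 'rV[R]_n).

Lemma integrable_bounded_support f c r B :
  measurable_fun setT f -> (forall x, `|f x| <= B) ->
  (forall x, ~ closed_cube c r x -> f x = 0) ->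
  mu.-integrable setT (EFin \o f).
Proof.
move=> mf fB f0.
have -> : EFin \o f = (EFin \o f) \_ (closed_cube c r).
  apply/funext => x; rewrite /patch; case: ifPn => // /negP h.
  by rewrite /= f0// => /mem_set.
apply/(integrable_mkcond _ (measurable_closed_cube c r)).
apply: measurable_bounded_integrable.
- exact: measurable_closed_cube.
- exact: lebesgue_rV_closed_cube_lty.
- exact: measurable_funTS.
- exists B; split => [|M BM x _ /=]; first exact: num_real.
  by apply: (le_trans (fB x)); exact: ltW.
Qed.

Lemma continuous_support_bounded f c r : continuous f ->
  (forall x, ~ closed_cube c r x -> f x = 0) ->
  exists2 B, 0 <= B & forall x, `|f x| <= B.
Proof.
move=> cf f0.
have /compact_bounded[M [_ HM]] : compact (f @` closed_cube c r).
  apply: continuous_compact; last exact: closed_cube_compact.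
  by apply: continuous_subspaceT.
exists (`|M| + 1) => [|x]; first by rewrite addr_ge0.
have [cx|cx] := pselect (closed_cube c r x); last first.
  by rewrite f0// normr0 addr_ge0.
apply: (HM (`|M| + 1)); last by exists x.
by rewrite (le_lt_trans (ler_norm M))// ltrDl.
Qed.

Lemma integrable_continuous_support f c r : continuous f ->
  (forall x, ~ closed_cube c r x -> f x = 0) ->
  mu.-integrable setT (EFin \o f).
Proof.
move=> cf f0; have [B _ fB] := continuous_support_bounded cf f0.
exact: (integrable_bounded_support (continuous_measurable_rV cf) fB f0).
Qed.

Lemma Rintegral_translation f (v : 'rV[R]_n) :
  mu.-integrable setT (EFin \o f) ->
  mu.-integrable setT (EFin \o (fun x => f (x + v))) /\
  \int[mu]_x f (x + v) = \int[mu]_x f x.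
Proof.
move=> intf.
pose T (x : 'rV[R]_n) : 'rV[R]_n := x + v.
have mT : measurable_fun setT T.
  apply: measurable_fun_rV => i; under eq_fun do rewrite mxE.
  by apply: measurable_funD => //; exact: measurable_coord.
pose nu := measure_function_pushforward__canonical__measure_function_Measure mu mT.
have numu A : measurable A -> nu A = mu A.
  by move=> mA; exact: lebesgue_rV_translation.
have mf : measurable_fun setT (EFin \o f) by case/integrableP: intf.
have intfT : mu.-integrable setT (EFin \o (fun x => f (x + v))).
  apply/integrableP; split.
    by apply: (measurableT_comp mf mT).
  case/integrableP: intf => _; apply: le_lt_trans.
  rewrite le_eqVlt; apply/orP; left; apply/eqP.
  have := @ge0_integral_pushforward _ _ _ _ R T mT mu setT (abse \o (EFin \o f))
    measurableT (measurableT_comp (@abse_measurable R setT) mf) (fun _ _ => abse_ge0 _).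
  rewrite preimage_setT => <-.
  by apply: (@eq_measure_integral _ _ _ _ mu nu) => A mA _; exact: numu.
split => //; congr fine.
have := @integral_pushforward _ _ _ _ R T mT mu setT (EFin \o f) mf.
rewrite preimage_setT => /(_ intfT measurableT) <-.
by apply: (@eq_measure_integral _ _ _ _ mu nu) => A mA _; exact: numu.
Qed.

End bounded_support.

Lemma Rintegral_dominated_cvg d (T : measurableType d) (R : realType)
    (mu : {measure set T -> \bar R}) (f_ : nat -> T -> R) (f g : T -> R) :
  (forall k, measurable_fun setT (f_ k)) ->
  (forall x, f_ ^~ x @ \oo --> f x) ->
  mu.-integrable setT (EFin \o g) ->
  (forall k x, `|f_ k x| <= g x) ->
  mu.-integrable setT (EFin \o f) /\
  (\int[mu]_x f_ k x) @[k --> \oo] --> \int[mu]_x f x.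
Proof.
move=> mf_ cf ig fg.
have mf : measurable_fun setT f.
  by apply: (measurable_fun_cvg mf_) => x _; exact: cf.
have [|||||h1 _ h2] := @dominated_convergence _ T R mu setT measurableT
  (fun k => EFin \o f_ k) (EFin \o f) (EFin \o g).
- by move=> k; exact/measurable_EFinP.
- exact/measurable_EFinP.
- by apply: aeW => x _; apply: cvg_EFin; [exact: nearW|exact: cf].
- exact: ig.
- by apply: aeW => x k _; rewrite /= lee_fin.
split => //; apply: fine_cvg.
by rewrite fineK//; exact: integrable_fin_num.
Qed.

Section integral_partial.
Context {R : realType} {n : nat}.
Local Notation mu := (@lebesgue_rV R n).

Lemma mean_value_partial (f : 'rV[R]_n -> R) (i : 'I_n) (x : 'rV[R]_n) (h : R) :
  (forall y, differentiable f y) -> 0 < h ->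
  exists c, f (x + h *: delta_mx 0 i) - f x =
    partial i f (x + c *: delta_mx 0 i) * h.
Proof.
move=> df h0; set e := delta_mx 0 i : 'rV[R]_n.
have dg (s : R) : is_derive s (1 : R) (fun s => f (x + s *: e))
    (partial i f (x + s *: e)).
  have : derivable f (x + s *: e) e by apply: diff_derivable; exact: df.
  rewrite /derivable /partial /derive -/e.
  set L := lim _ => cv.
  suff E : (fun k : R => k^-1 *: (((fun s => f (x + s *: e)) \o shift s) (k *: 1)
      - f (x + s *: e))) = (fun k : R => k^-1 *: ((f \o shift (x + s *: e)) (k *: e)
      - f (x + s *: e))).
    by apply: DeriveDef; rewrite /derivable /derive E.
  apply/funext => k; rewrite /= /shift; congr (_ *: (f _ - _)).
  by rewrite -[k *: 1]/(k * 1) mulr1 scalerDl addrCA.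
have [|c _ E] := @MVT R (fun s => f (x + s *: e)) (fun s => partial i f (x + s *: e))
    0 h h0 (fun s _ => dg s).
  apply: continuous_subspaceT => s; apply: differentiable_continuous.
  by apply/derivable1_diffP; case: (dg s).
by exists c; rewrite -[x in _ - f x]addr0 -(scale0r e) E subr0.
Qed.

(** The difference quotients of f in direction i have integral zero by
    translation invariance, converge to the partial derivative, and are dominated
    by K on a slightly larger cube because of the mean value theorem. *)
Lemma integral_partial_eq0 (f : 'rV[R]_n -> R) (i : 'I_n) (M K : R) :
  (forall x, differentiable f x) -> (forall x, `|partial i f x| <= K) ->
  (forall x, ~ closed_cube 0 M x -> f x = 0) ->
  \int[mu]_x partial i f x = 0.
Proof.
move=> df fK f0; set e := delta_mx 0 i : 'rV[R]_n.
have cf : continuous f by move=> x; exact: differentiable_continuous.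
have intf := integrable_continuous_support cf f0.
pose h := @harmonic R.
have h0 k : 0 < h k by exact: harmonic_gt0.
have h1 k : h k <= 1 by rewrite invf_le1 ?ltr0n// ler1n.
pose q k x := (h k)^-1 * (f (x + h k *: e) - f x).
have intq k : mu.-integrable setT (EFin \o q k) /\ \int[mu]_x q k x = 0.
  have [i1 i2] := Rintegral_translation (h k *: e) intf.
  have i3 := integrableB measurableT i1 intf.
  split; first exact: (integrableZl measurableT ((h k)^-1) i3).
  by rewrite RintegralZl// RintegralB// i2 subrr mulr0.
(* Translations by at most 1 move the support by at most 1. *)
have f1 x s : `|s| <= 1 -> ~ closed_cube 0 (M + 1) x -> f (x + s *: e) = 0.
  move=> s1 nx; apply: f0; apply: contra_not nx => cx j.
  have := cx j; rewrite !mxE eqxx /= !subr0 => cxj.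
  have : `|s * (j == i)%:R| <= 1.
    by case: (j == i); rewrite ?mulr1 ?mulr0 ?normr0.
  have := ler_normB (x 0 j + s * (j == i)%:R) (s * (j == i)%:R).
  rewrite addrK; lra.
have cq x : q ^~ x @ \oo --> partial i f x.
  have /cvgr_dnbhsP/(_ h) : (fun s : R => s^-1 *: ((f \o shift x) (s *: e) - f x)) s
      @[s --> 0^'] --> partial i f x by exact: (diff_derivable (v := e) (df x)).
  move=> /(_ (conj (fun k => lt0r_neq0 (h0 k)) cvg_harmonic)).
  rewrite (_ : q ^~ x = (fun k => (h k)^-1 *: ((f \o shift x) (h k *: e) - f x)))//.
  by apply/funext => k; rewrite /q /= [x + _]addrC.
have qK k x : `|q k x| <= K * \1_(closed_cube 0 (M + 1)) x.
  rewrite indicE; have [_|/negP nx] := boolP (x \in _); last first.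
    rewrite mulr0 /q f1; last 2 first.
    - by rewrite ger0_norm// ltW.
    - by move=> cx; apply: nx; rewrite inE.
    rewrite (_ : f x = 0) ?subr0 ?mulr0 ?normr0//.
    rewrite -[x]addr0 -(scale0r e); apply: f1; rewrite ?normr0//.
    by move=> cx; apply: nx; rewrite inE.
  rewrite mulr1 /q; have [c ->] := @mean_value_partial f i x (h k) df (h0 k).
  by rewrite mulrCA mulVf ?mulr1 ?fK// gt_eqF.
have ig : mu.-integrable setT (EFin \o (fun x => K * \1_(closed_cube 0 (M + 1)) x)).
  apply: (@integrable_bounded_support _ _ _ (0 : 'rV[R]_n) (M + 1) `|K|).
  - by apply: measurable_funM => //; apply: measurable_indic;
      exact: measurable_closed_cube.
  - move=> x; rewrite normrM ler_piMr// indicE.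
    by case: (_ \in _); rewrite ?normr1 ?normr0.
  - by move=> x nx; rewrite indicE memNset// mulr0.
have mq k : measurable_fun setT (q k).
  by case: (intq k) => /integrableP[/measurable_EFinP].
have [_] := Rintegral_dominated_cvg mq cq ig qK.
have -> : (fun k => \int[mu]_x q k x) = cst 0.
  by apply/funext => k; case: (intq k).
by move=> c0; apply/esym; apply: (cvg_unique _ (cvg_cst _) c0).
Qed.

End integral_partial.

(** * Smooth functions built from exp (- 1 / t) *)

Section flat_function.
Context {R : realType}.
Implicit Types (p : {poly R}) (t : R).

(** The functions p(1/t) exp(-1/t), extended by 0, form a class that is closed
    under derivation. *)
Definition flat p t : R := if 0 < t then p.[t^-1] * expR (- t^-1) else 0.

Definition flat_deriv p : {poly R} := 'X^2 * (p - p^`()).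

(** exp y dominates y ^ (k + 2) / (k + 2)!, and y = 1 / t. *)
Lemma flat_le p : exists2 C : R, 0 <= C & forall t, `|flat p t| <= C * t ^+ 2.
Proof.
exists (\sum_(k < size p) `|p`_k| * (k.+2)`!%:R).
  by apply: sumr_ge0 => k _; rewrite mulr_ge0// ler0n.
move=> t; rewrite /flat; case: ifPn => [t0|_]; last first.
  rewrite normr0 mulr_ge0 ?sqr_ge0//.
  by apply: sumr_ge0 => k _; rewrite mulr_ge0// ler0n.
rewrite horner_coef mulr_suml mulr_suml.
apply: (le_trans (ler_norm_sum _ _ _)); apply: ler_sum => k _.
rewrite -!mulrA normrM ler_wpM2l//.
have y0 : 0 < t^-1 by rewrite invr_gt0.
rewrite ger0_norm; last by rewrite mulr_ge0 ?expR_ge0// exprn_ge0// ltW.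
have := expR_ge1Dxn k.+1 (ltW y0).
set y := t^-1; move=> h.
have tE : t = y^-1 by rewrite invrK.
have {}h : y ^+ k.+2 / (k.+2)`!%:R <= expR y.
  by apply: le_trans h; rewrite lerDr.
have f0 : 0 < (k.+2)`!%:R :> R by rewrite ltr0n fact_gt0.
rewrite ler_pdivrMr// in h.
have -> : y ^+ k = y ^+ k.+2 * t ^+ 2.
  by rewrite -addn2 exprD -mulrA -exprMn tE mulfV ?gt_eqF// expr1n mulr1.
rewrite mulrAC; apply: ler_wpM2r; first exact: sqr_ge0.
have := ler_wpM2r (expR_ge0 (- y)) h; move=> /le_trans; apply.
by rewrite mulrAC -expRD subrr expR0 mul1r.
Qed.

(** At 0 the quadratic bound of flat_le forces the derivative to vanish. *)
Lemma is_derive_flat p t : is_derive t (1 : R) (flat p) (flat (flat_deriv p) t).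
Proof.
have [t0|t0|->] := ltgtP t 0.
- have -> : flat (flat_deriv p) t = 0 by rewrite /flat ltNge (ltW t0).
  apply: (near_eq_is_derive (f := cst 0)).
  have := lt_nbhsl t0; apply: filterS => s s0.
  by rewrite /flat ltNge (ltW s0).
- rewrite /flat t0.
  have dV : is_derive t (1 : R) (fun s : R => s^-1) (- t ^- 2).
    by have := is_deriveV (lt0r_neq0 t0) (is_derive_id t (1 : R));
      rewrite -[_ *: 1]/(_ * 1) mulr1.
  have d1 : is_derive t (1 : R) (fun s => p.[s^-1]) (p^`().[t^-1] * (- t ^- 2)).
    exact: (@is_derive1_comp R (horner p) (fun s => s^-1)).
  have d2 : is_derive t (1 : R) (fun s => expR (- s^-1))
      (expR (- t^-1) * (t ^- 2)).
    have := @is_derive1_comp R expR (fun s => - s^-1) t _ _ (is_derive_expR _)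
      (is_deriveN dV).
    by rewrite opprK.
  have dM : is_derive t (1 : R) (fun s => p.[s^-1] * expR (- s^-1))
      ((flat_deriv p).[t^-1] * expR (- t^-1)).
    apply: is_derive_eq; rewrite /flat_deriv !hornerE -!exprVn.
    by rewrite -![_ *: _]/(_ * _); ring.
  apply: (near_eq_is_derive _ dM).
  have := lt_nbhsr t0; apply: filterS => s s0.
  by rewrite /flat s0.
- have -> : flat (flat_deriv p) 0 = 0 by rewrite /flat ltxx.
  have [C C0 HC] := flat_le p.
  suff cv : h^-1 *: ((flat p \o shift 0) (h *: (1 : R)) - flat p 0)
      @[h --> 0^'] --> (0 : R).
    by apply: DeriveDef; [apply/cvg_ex; exists 0|exact/cvg_lim].
  have c0 : C * `|h| @[h --> (0 : R)^'] --> (0 : R).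
    have e : C * `|0 : R| = 0 by rewrite normr0 mulr0.
    rewrite -[X in _ --> X]e; apply: cvgMr; apply: cvg_norm.
    by apply: cvg_within_filter; exact: cvg_id.
  have c0' : - (C * `|h|) @[h --> (0 : R)^'] --> (0 : R).
    by rewrite -[X in _ --> X]oppr0; exact: cvgN.
  apply: (squeeze_cvgr _ c0' c0).
  have nz : \forall h \near (0 : R)^', h != 0 by exact: nbhs_dnbhs_neq.
  apply: filterS nz => h h0; rewrite -ler_norml.
  have -> : flat p 0 = 0 by rewrite /flat ltxx.
  rewrite /= /shift subr0 -[h *: 1]/(h * 1) mulr1 addr0 -[_ *: _]/(_ * _).
  rewrite normrM normfV mulrC ler_pdivrMr ?normr_gt0//.
  by rewrite -mulrA -normrM -expr2 (ger0_norm (sqr_ge0 h)) HC.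
Qed.

End flat_function.

Section smooth_algebra.
Context {R : realType} {n : nat}.
Implicit Types f g : 'rV[R]_n -> R.

(** A class of functions closed under partial derivatives by construction, so
    that a single induction shows all of its members to be smooth. *)
Inductive smooth_term : ('rV[R]_n -> R) -> Prop :=
| SmoothCst c : smooth_term (cst c)
| SmoothFlat (p : {poly R}) (i : 'I_n) (a b : R) :
    smooth_term (fun x => flat p (a * x 0 i + b))
| SmoothAdd f g : smooth_term f -> smooth_term g -> smooth_term (f + g)
| SmoothMul f g : smooth_term f -> smooth_term g -> smooth_term (f * g).

Lemma smooth_term_prod (I : Type) (r : seq I) (F : I -> 'rV[R]_n -> R) :
  (forall i, smooth_term (F i)) -> smooth_term (\prod_(i <- r) F i).
Proof.
move=> sF; apply: (big_ind smooth_term) => //; first exact: SmoothCst.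
exact: SmoothMul.
Qed.

Let aff (i : 'I_n) (a b : R) (x : 'rV[R]_n) : R := a * x 0 i + b.

Let diff_aff i a b x : differentiable (aff i a b) x.
Proof.
apply: differentiableD => //; apply: differentiableM => //.
exact: differentiable_coord.
Qed.

Let derive_aff i j a b x : 'D_(delta_mx 0 j) (aff i a b) x = a * (i == j)%:R.
Proof.
rewrite /derive; apply: cvg_lim => //; apply: cvg_near_cst.
have nz : \forall h \near (0 : R)^', h != 0 by exact: nbhs_dnbhs_neq.
apply: filterS nz => h h0; rewrite /= /shift /aff !mxE eqxx/=.
by rewrite -[_ *: _]/(_ * _); field.
Qed.

Lemma smooth_term_differentiable f x : smooth_term f -> differentiable f x.
Proof.
move=> sf; elim: sf x => [c x|p i a b x|{}f g _ df _ dg x|{}f g _ df _ dg x] //.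
- apply: (@differentiable_comp _ _ _ _ (aff i a b) (flat p)) => //.
  by apply/derivable1_diffP; have [] := is_derive_flat p (aff i a b x).
- exact: differentiableD.
- exact: differentiableM.
Qed.

Lemma smooth_term_partial f j : smooth_term f -> smooth_term (partial j f).
Proof.
elim => [c|p i a b|{}f g sf df sg dg|{}f g sf df sg dg].
- rewrite (_ : partial j _ = cst 0); first exact: SmoothCst.
  by apply/funext => x; rewrite /partial derive_cst.
- rewrite (_ : partial j _ = cst (a * (i == j)%:R) *
      (fun x => flat (flat_deriv p) (a * x 0 i + b))).
    by apply: SmoothMul; [exact: SmoothCst|exact: SmoothFlat].
  apply/funext => x; rewrite /partial.
  have [d1 d2] := is_derive_flat p (aff i a b x).
  have d1' : differentiable (flat p) (aff i a b x) by apply/derivable1_diffP.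
  rewrite (_ : (fun _ => _) = flat p \o aff i a b)// deriveE; last first.
    exact: differentiable_comp.
  have dE : 'd (aff i a b) x (delta_mx 0 j) = a * (i == j)%:R :> R.
    by rewrite -deriveE// derive_aff.
  rewrite diff_comp//= dE diff1E// derive1E d2.
  by rewrite -[_ *: _]/(_ * _).
- rewrite (_ : partial j _ = partial j f + partial j g); first exact: SmoothAdd.
  apply/funext => x; rewrite /partial deriveD//;
    by apply: diff_derivable; exact: smooth_term_differentiable.
- rewrite (_ : partial j _ = f * partial j g + g * partial j f).
    by apply: SmoothAdd; exact: SmoothMul.
  apply/funext => x; rewrite /partial deriveM//;
    by apply: diff_derivable; exact: smooth_term_differentiable.
Qed.

Lemma smooth_term_smooth f : smooth_term f -> smooth_on setT f.
Proof.
move=> sf s x _; apply: smooth_term_differentiable.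
by elim: s => //= i s; exact: smooth_term_partial.
Qed.

End smooth_algebra.

(** * Bump functions and orthants *)

Section bump.
Context {R : realType} {n : nat}.
Implicit Types (a b x : 'rV[R]_n).

Definition open_box a b : set 'rV[R]_n :=
  [set x | forall i, a 0 i < x 0 i /\ x 0 i < b 0 i].

(** On the box, the product over i of exp (- 1 / (m (x_i - a_i))) and
    exp (- 1 / (m (b_i - x_i))) with m = k + 1; zero elsewhere. *)
Definition bump a b (k : nat) : 'rV[R]_n -> R :=
  \prod_(i < n) ((fun x => flat 1 (k.+1%:R * x 0 i + - k.+1%:R * a 0 i)) *
                 (fun x => flat 1 (- k.+1%:R * x 0 i + k.+1%:R * b 0 i))).

Lemma bumpE a b k x : bump a b k x = \prod_(i < n)
  (flat 1 (k.+1%:R * (x 0 i - a 0 i)) * flat 1 (k.+1%:R * (b 0 i - x 0 i))).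
Proof.
rewrite /bump; elim/big_rec2: _ => [//|i y1 y2 _ <-].
rewrite -[LHS]/(_ * _ * _); congr (flat _ _ * flat _ _ * _); ring.
Qed.

Lemma flat1_ge0 (t : R) : 0 <= flat 1 t.
Proof. by rewrite /flat; case: ifP => // _; rewrite hornerC mul1r expR_ge0. Qed.

Lemma flat1_le1 (t : R) : flat 1 t <= 1.
Proof.
rewrite /flat; case: ifPn => // t0; rewrite hornerC mul1r -[leRHS]expR0 ler_expR.
by rewrite oppr_le0 invr_ge0 ltW.
Qed.

Lemma bump_ge0 a b k x : 0 <= bump a b k x.
Proof. by rewrite bumpE; apply: prodr_ge0 => i _; rewrite mulr_ge0 ?flat1_ge0. Qed.

Lemma bump_le1 a b k x : bump a b k x <= 1.
Proof.
rewrite bumpE; apply: Num.Theory.prodr_ile1 => i _; apply/andP; split.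
  by rewrite mulr_ge0 ?flat1_ge0.
by rewrite mulr_ile1 ?flat1_ge0 ?flat1_le1.
Qed.

Lemma bump_eq0 a b k x : ~ open_box a b x -> bump a b k x = 0.
Proof.
move=> /existsNP[i ni]; rewrite bumpE (bigD1 i)//=.
suff -> : flat 1 (k.+1%:R * (x 0 i - a 0 i)) * flat 1 (k.+1%:R * (b 0 i - x 0 i)) = 0.
  by rewrite mul0r.
rewrite /flat !pmulr_rgt0 ?ltr0n// !subr_gt0.
case: ifPn => [ax|_]; last by rewrite mul0r.
case: ifPn => [xb|_]; last by rewrite mulr0.
by case: ni.
Qed.

(** Each factor exp (- 1 / (m s)) with s > 0 tends to 1 as m grows. *)
Lemma cvg_bump a b x : bump a b k x @[k --> \oo] --> (\1_(open_box a b) x : R).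
Proof.
rewrite indicE; have [/[!inE] bx|/negP nx] := boolP (x \in open_box a b); last first.
  under eq_fun do rewrite bump_eq0 => [|/mem_set//].
  exact: cvg_cst.
under eq_fun do rewrite bumpE.
have flat_cvg (t : R) : 0 < t -> flat 1 (k.+1%:R * t) @[k --> \oo] --> (1 : R).
  move=> t0.
  have -> : (fun k => flat 1 (k.+1%:R * t)) = (fun k => expR (- (t^-1 * harmonic k))).
    apply/funext => k; rewrite /flat pmulr_rgt0 ?ltr0n// t0 hornerC mul1r.
    by rewrite invfM mulrC.
  rewrite -[X in _ --> X]expR0.
  apply: continuous_cvg; first exact: continuous_expR.
  rewrite -[X in _ --> X]oppr0; apply: cvgN; rewrite -[X in _ --> X](mulr0 t^-1).
  by apply: cvgMr; exact: cvg_harmonic.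
rewrite (_ : true%:R = \prod_(i < n) (1 * 1)); last by rewrite mulr1 big1.
apply: cvg_big => [|i _]; first exact: mul_continuous.
have [h1 h2] := bx i.
by apply: cvgM; apply: flat_cvg; rewrite subr_gt0.
Qed.

Lemma test_function_bump (Omega : set 'rV[R]_n) a b c r k :
  open_box a b `<=` closed_cube c r -> closed_cube c r `<=` Omega ->
  test_function Omega (bump a b k).
Proof.
move=> bc cO.
have sub : closure [set x | bump a b k x != 0] `<=` closed_cube c r.
  apply: (subset_trans _ (@closed_cube_closed _ _ c r)); apply: closureS => x /= b0.
  apply: bc; apply: contrapT => nx; move: b0; rewrite bump_eq0 ?eqxx//.
split.
- apply: smooth_term_smooth; apply: smooth_term_prod => i.
  by apply: SmoothMul; exact: SmoothFlat.
- apply: (subclosed_compact _ (@closed_cube_compact _ _ c r)) => //.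
  exact: closed_closure.
- exact: subset_trans cO.
Qed.

End bump.

Section generation.
Context {R : realType} {n : nat}.

Definition orthant (a : 'rV[R]_n) : set 'rV[R]_n :=
  [set x | forall i, a 0 i < x 0 i].

(** Orthants are stable under intersection, which is what a pi-lambda argument
    needs. They generate because a half-space is a countable union of orthants. *)
Lemma measurable_orthantE :
  @measurable _ 'rV[R]_n = <<s range orthant >>.
Proof.
apply/seteqP; split => A mA; last first.
  move: A mA; apply: smallest_sub; first exact: sigma_algebra_measurable.
  move=> _ [a _ <-].
  have -> : orthant a =
    [set x | forall i, (`](a 0 i), +oo[%classic : set R) (x 0 i)].
    by apply/seteqP; split => x /= h i; have := h i; rewrite in_itv /= andbT.
  exact: (@measurable_coords _ _ (fun i => `](a 0 i), +oo[%classic)).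
pose T := g_sigma_algebraType (range orthant).
have mid : measurable_fun setT (id : T -> 'rV[R]_n).
  apply: measurable_fun_rV => i.
  apply: (measurability _ (RGenOInfty.measurableE R)).
  move=> _ [_ [y ->] <-]; rewrite setTI.
  pose a (k : nat) : 'rV[R]_n := \row_j (if j == i then y else - k%:R).
  suff -> : (fun x : 'rV[R]_n => x 0 i) @^-1` `]y, +oo[%classic =
      \bigcup_k orthant (a k).
    by apply: bigcupT_measurable => k; apply: sub_sigma_algebra; exists (a k).
  apply/seteqP; split => x /=; last first.
    by move=> [k _ /(_ i)]; rewrite mxE eqxx in_itv/= andbT.
  rewrite in_itv /= andbT => yx.
  exists (Num.truncn (\sum_j `|x 0 j|)).+1 => // j; rewrite mxE.
  case: ifPn => [/eqP -> //|_].
  rewrite ltrNl; apply: (@le_lt_trans _ _ (\sum_j `|x 0 j|)); last first.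
    by apply: truncnS_gt.
  rewrite (bigD1 j)//=; apply: (le_trans (ler_norm _)); rewrite normrN lerDl.
  exact: sumr_ge0.
have := mid measurableT A mA; by rewrite setTI.
Qed.

End generation.

(** * Square integrable functions orthogonal to all test functions *)

Section square_integrable.
Context d (T : measurableType d) (R : realType) (mu : {measure set T -> \bar R}).
Implicit Types f g : T -> R.

Lemma Lfun2_measurable f : f \in Lfun mu 2%:E -> measurable_fun setT f.
Proof. by rewrite inE => /andP[/[!inE]]. Qed.

Lemma Lfun2P f : f \in Lfun mu 2%:E <->
  measurable_fun setT f /\ mu.-integrable setT (EFin \o (fun x => f x ^+ 2)).
Proof.
split=> [f2|[mf if2]].
  by split; [exact: Lfun2_measurable|exact: Lfun2_integrable_sqr].
rewrite inE; apply/andP; split; rewrite inE //=.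
rewrite /finite_norm unlock /Lnorm; apply: poweR_lty.
have /integrableP[_] := if2; apply: le_lt_trans.
rewrite le_eqVlt; apply/orP; left; apply/eqP; apply: eq_integral => x _ /=.
by rewrite powR_mulrn// normrX.
Qed.

Lemma Lfun2_integrable_mul f g :
  f \in Lfun mu 2%:E -> g \in Lfun mu 2%:E ->
  mu.-integrable setT (EFin \o (fun x => f x * g x)).
Proof. by move=> f2 g2; apply/Lfun1_integrable; exact: Lfun2_mul_Lfun1. Qed.

End square_integrable.

Section vanishing.
Context {R : realType} {n : nat}.
Local Notation mu := (@lebesgue_rV R n).

Lemma Lfun2_bounded_support (f : 'rV[R]_n -> R) c r B :
  measurable_fun setT f -> (forall x, `|f x| <= B) ->
  (forall x, ~ closed_cube c r x -> f x = 0) -> f \in Lfun mu 2%:E.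
Proof.
move=> mf fB f0; apply/Lfun2P; split => //.
apply: (@integrable_bounded_support _ _ _ c r (B ^+ 2)).
- exact: measurable_funX.
- by move=> x; rewrite normrX ler_pXn2r// nnegrE (le_trans _ (fB x)).
- by move=> x /f0 ->; rewrite expr0n.
Qed.

Lemma Lfun2_indic_cube c r : \1_(@cube R n c r) \in Lfun mu 2%:E.
Proof.
apply: (@Lfun2_bounded_support _ c r 1).
- by apply: measurable_indic; exact: measurable_cube.
- by move=> x; rewrite indicE; case: (_ \in _); rewrite ?normr1 ?normr0.
- move=> x nx; rewrite indicE memNset//.
  by apply: contra_not nx; exact: subset_cube_closed_cube.
Qed.

Variables (Omega : set 'rV[R]_n) (F : 'rV[R]_n -> R).
Hypothesis F2 : F \in Lfun mu 2%:E.
Hypothesis F_orth : forall phi, test_function Omega phi ->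
  \int[mu]_x (F x * phi x) = 0.

(** Dominated convergence for the integrals of F against bump functions. *)
Lemma integral_box_eq0 a b c r : open_box a b `<=` cube c r ->
  closed_cube c r `<=` Omega -> \int[mu]_x (F x * \1_(open_box a b) x) = 0.
Proof.
move=> bc cO.
have tb k : test_function Omega (bump a b k).
  apply: test_function_bump cO; apply: subset_trans bc _.
  exact: subset_cube_closed_cube.
have iF : mu.-integrable setT (EFin \o (fun x => `|F x| * \1_(cube c r) x)).
  have := integrable_abse (Lfun2_integrable_mul F2 (Lfun2_indic_cube c r)).
  congr (mu.-integrable _ _); apply/funext => x /=; rewrite normrM.
  by rewrite [`|\1_(_) _|]ger0_norm// indicE ler0n.
have [|||_] := @Rintegral_dominated_cvg _ _ R mu
  (fun k x => F x * bump a b k x) (fun x => F x * \1_(open_box a b) x) _ _ _ iF.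
- move=> k; apply: measurable_funM; first exact: Lfun2_measurable F2.
  apply: continuous_measurable_rV => x; apply: differentiable_continuous.
  by have [s _ _] := tb k; exact: (s [::]).
- by move=> x; apply: cvgMr; exact: cvg_bump.
- move=> k x; rewrite normrM ler_wpM2l// ger0_norm ?bump_ge0//.
  have [cx|cx] := pselect (open_box a b x).
    by rewrite indicE mem_set ?bump_le1//; exact: bc.
  by rewrite bump_eq0// indicE ler0n.
have -> : (fun k => \int[mu]_x (F x * bump a b k x)) = cst 0.
  by apply/funext => k; exact: F_orth.
by move=> c0; apply/esym; apply: (cvg_unique _ (cvg_cst _) c0).
Qed.

(** The sets on which F, cut off to the cube, has integral zero form a Dynkin
    class, and an orthant meets the cube in a box. *)
Lemma orthogonal_cube_ae_eq0 c r : closed_cube c r `<=` Omega ->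
  {ae mu, forall x, cube c r x -> F x = 0}.
Proof.
move=> cO.
pose h x := F x * \1_(cube c r) x.
have ih : mu.-integrable setT (EFin \o h).
  exact: Lfun2_integrable_mul F2 (Lfun2_indic_cube c r).
have cubeE' : cube c r = open_box (\row_i (c 0 i - r)) (\row_i (c 0 i + r)).
  apply/seteqP; split => x /= hx i; have := hx i; rewrite !mxE ltr_distl.
    by move=> /andP.
  by move=> [-> ->].
have hT : (\int[mu]_x (h x)%:E = 0)%E.
  have := @integral_box_eq0 (\row_i (c 0 i - r)) (\row_i (c 0 i + r)) c r.
  rewrite -cubeE' => /(_ (@subset_refl _ _) cO) => h0.
  by rewrite -[LHS]fineK ?[fine _]h0//; exact: integrable_fin_num ih.
have hA A : measurable A -> (\int[mu]_(x in A) (h x)%:E = 0)%E.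
  rewrite measurable_orthantE.
  apply: (@dynkin_induction _ _ (range orthant)
    (fun A => \int[mu]_(x in A) (h x)%:E = 0)%E measurable_orthantE) => //.
  - move=> _ _ [a _ <-] [b _ <-].
    exists (\row_i Num.max (a 0 i) (b 0 i)) => //.
    apply/seteqP; split => x /=.
      by move=> hx; split=> i; have := hx i; rewrite mxE gt_max => /andP[].
    by move=> [h1 h2] i; rewrite mxE gt_max h1 h2.
  - move=> _ [a _ <-].
    (* The lower corner of the box in which the orthant meets the cube. *)
    pose a' : 'rV[R]_n := \row_i Num.max (a 0 i) (c 0 i - r).
    have E : orthant a `&` cube c r = open_box a' (\row_i (c 0 i + r)).
      rewrite cubeE'; apply/seteqP; split => x /=.
        move=> [h1 h2] i; have := h2 i; rewrite !mxE => -[h3 h4].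
        by rewrite gt_max h1 h3.
      move=> hx; split=> i; have := hx i; rewrite !mxE gt_max => -[/andP[]] //.
    have sub : open_box a' (\row_i (c 0 i + r)) `<=` cube c r.
      by rewrite -E => x [].
    have := integral_box_eq0 sub cO; rewrite -E => h0.
    have ma : measurable (orthant a).
      by rewrite measurable_orthantE; apply: sub_sigma_algebra; exists a.
    rewrite -[LHS]fineK; last first.
      by apply: integrable_fin_num => //; apply: integrableS ih.
    rewrite -/(Rintegral mu (orthant a) h) Rintegral_mkcond.
    congr (_%:E); rewrite -[RHS]h0.
    apply: eq_Rintegral => x _; rewrite /patch /h !indicE in_setI.
    by case: (x \in orthant a); rewrite ?mulr0.
  - move=> S mS hS.
    have := @integral_setU _ _ R mu S (~` S) (EFin \o h) mS (measurableC mS).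
    rewrite setUCr hT hS add0e => <- //.
    + by case/integrableP: ih.
    + by apply/disj_setPCl.
  - move=> G mG tG hG.
    rewrite integral_bigcup//; last first.
      by apply: integrableS ih => //; exact: bigcupT_measurable.
    by apply: eseries0 => k _ _; exact: hG.
have := @integral_ae_eq _ _ R mu setT measurableT (cst 0%E) (EFin \o h) ih
  (measurable_cst _).
move=> /(_ _)/wrap[A _ mA|]; first by rewrite hA// integral0.
apply: filterS => x /(_ I) /= + cx; rewrite /h indicE mem_set// mulr1.
by case.
Qed.

Hypothesis Omega_open : open Omega.

Lemma orthogonal_ae_eq0 : {ae mu, forall x, Omega x -> F x = 0}.
Proof.
have [C CE CP] := open_cube_cover Omega_open.
have : {ae mu, forall x, forall m, C m x -> F x = 0}.
  apply: ae_foralln => m; case: (CP m) => [->|[c [r [_ -> cO]]]].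
    exact: aeW.
  exact: orthogonal_cube_ae_eq0 cO.
by apply: filterS => x h; rewrite -CE => -[m _ /h].
Qed.

End vanishing.

(** * The inner product of square integrable functions *)

Section L2_inner_product.
Context {R : realType} {n : nat} (Omega : set 'rV[R]_n).
Local Notation mu := (@lebesgue_rV R n).
Implicit Types f g h u phi : 'rV[R]_n -> R.

Definition L2ip f g : R := \int[mu]_x ((f \_ Omega) x * (g \_ Omega) x).

Lemma patch_axpy (a : R) f g :
  (a *: f + g) \_ Omega = a *: (f \_ Omega) + g \_ Omega.
Proof.
apply/funext => x; rewrite /patch.
rewrite -[RHS]/(a *: (if x \in Omega then f x else 0) +
  (if x \in Omega then g x else 0)).
by case: ifP => // _; rewrite scaler0 addr0.
Qed.

Lemma subspace_L2 : subspace (L2 Omega).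
Proof.
have [L0 Llin] := Lfun_submod_closed mu (lee1n 2).
split=> [|a f g f2 g2].
  rewrite /L2 (_ : _ \_ _ = 0)//.
  by apply/funext => x; rewrite /patch; case: ifP.
by rewrite /L2 patch_axpy; exact: Llin.
Qed.

Lemma Rintegral_L2ip f g : \int[mu]_(x in Omega) (f x * g x) = L2ip f g.
Proof.
rewrite Rintegral_mkcond /L2ip; apply: eq_Rintegral => x _.
by rewrite /patch; case: ifP => // _; rewrite mulr0.
Qed.

Lemma semi_inner_L2 : semi_inner_on (L2 Omega) L2ip.
Proof.
apply: semi_inner_of_left.
- exact: subspace_L2.
- by move=> f g _ _; apply: eq_Rintegral => x _; rewrite mulrC.
- move=> a f g h f2 g2 h2; rewrite /L2ip patch_axpy.
  under eq_Rintegral => x _ do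
    rewrite -[(_ + _) x]/(a * (f \_ Omega) x + (g \_ Omega) x) mulrDl -mulrA.
  have ifh := Lfun2_integrable_mul f2 h2; have igh := Lfun2_integrable_mul g2 h2.
  rewrite RintegralD ?RintegralZl//.
  exact: (integrableZl measurableT a ifh).
- by move=> f f2; apply: Rintegral_ge0 => x _; rewrite -expr2 sqr_ge0.
Qed.

Lemma L2normE f : L2 Omega f -> L2norm Omega f = Num.sqrt (L2ip f f).
Proof.
move=> f2; have [_ if2] := (Lfun2P mu (f \_ Omega)).1 f2.
have e : \int[mu]_x (f \_ Omega) x ^+ 2 = L2ip f f.
  by apply: eq_Rintegral => x _; rewrite expr2.
rewrite /L2norm unlock /Lnorm.
under eq_integral => x _ do rewrite /= powR_mulrn// -normrX ger0_norm ?sqr_ge0//.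
have -> : (\int[mu]_x ((f \_ Omega) x ^+ 2)%:E)%E = (L2ip f f)%:E.
  by rewrite -e fineK//; exact: integrable_fin_num if2.
rewrite poweR_EFin /= powR12_sqrt//.
exact: (sip_ge0 semi_inner_L2).
Qed.

Lemma L2norm_sqr f : L2 Omega f -> L2norm Omega f ^+ 2 = L2ip f f.
Proof.
by move=> f2; rewrite L2normE// sqr_sqrtr//; exact: (sip_ge0 semi_inner_L2).
Qed.

Lemma L2norm_ge0 f : 0 <= L2norm Omega f.
Proof. by rewrite /L2norm fine_ge0// Lnorm_ge0. Qed.

Lemma L2_cauchy_schwarz f g : L2 Omega f -> L2 Omega g ->
  `|L2ip f g| <= L2norm Omega f * L2norm Omega g.
Proof.
move=> f2 g2; rewrite !L2normE//; exact: (sip_cauchy_schwarz semi_inner_L2).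
Qed.

Hypothesis Omega_open : open Omega.

Lemma test_function_support phi x :
  test_function Omega phi -> ~ Omega x -> phi x = 0.
Proof.
move=> [_ _ sub] nx; apply/eqP; apply: contraT => x0; exfalso; apply: nx.
by apply: sub; exact: subset_closure.
Qed.

Lemma patch_test_function phi : test_function Omega phi -> phi \_ Omega = phi.
Proof.
move=> tp; apply/funext => x; rewrite /patch; case: ifPn => // /negP nx.
by rewrite (test_function_support tp)// => /mem_set.
Qed.

(** Inner products do not see null sets, so this form of vanishing suffices to
    compare two weak derivatives. *)
Lemma weakly_zero f : L2 Omega f ->
  (forall phi, test_function Omega phi -> L2ip f phi = 0) ->
  forall g, L2 Omega g -> L2ip f g = 0.
Proof.
move=> f2 f0 g g2.
have : {ae mu, forall x, Omega x -> (f \_ Omega) x = 0}.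
  apply: (orthogonal_ae_eq0 f2) => // phi tp.
  by rewrite -(f0 _ tp) /L2ip (patch_test_function tp).
move=> ae0; rewrite /L2ip /Rintegral.
suff -> : (\int[mu]_x ((f \_ Omega) x * (g \_ Omega) x)%:E = 0)%E by [].
rewrite -[RHS](integral0 mu setT); apply: ae_eq_integral => //.
- by have /integrableP[] := Lfun2_integrable_mul f2 g2.
- apply: filterS ae0 => x h _ /=.
  have [Ox|nx] := pselect (Omega x); first by rewrite h// mul0r.
  by rewrite /patch memNset// mul0r.
Qed.

Lemma wpartialP i u : H1 Omega u ->
  L2 Omega (wpartial Omega i u) /\ is_weak_partial Omega i u (wpartial Omega i u).
Proof. by move=> [_ /(_ i)] /(xgetPex (cst 0)). Qed.

Lemma is_weak_partialE i u g : is_weak_partial Omega i u g <->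
  forall phi, test_function Omega phi ->
    L2ip u (partial i phi) = - L2ip g phi.
Proof. by split => h phi /h; rewrite !Rintegral_L2ip. Qed.

Hypothesis Omega_bounded : bounded_set Omega.

(** The norm is the maximum norm, so balls are cubes. *)
Lemma bounded_set_sub_cube :
  exists M, forall x, Omega x -> cube 0 M x.
Proof.
have [M [_ HM]] := Omega_bounded.
have M0 : 0 < `|M| + 1 by rewrite ltr_wpDl.
exists (`|M| + 1 + 1) => x Ox; rewrite -ball_cube; last by rewrite ltr_wpDl// ltW.
rewrite mx_norm_ball /ball_ /= sub0r normrN.
have := HM (`|M| + 1) _ x Ox => /= /(_ _)/wrap[|h].
  by rewrite (le_lt_trans (ler_norm M))// ltrDl.
by rewrite (le_lt_trans h)// ltrDl.
Qed.

Lemma test_function_cube phi : test_function Omega phi ->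
  exists M, forall x, ~ closed_cube 0 M x -> phi x = 0.
Proof.
move=> tp; have [M OM] := bounded_set_sub_cube; exists M => x nx.
apply: (test_function_support tp) => Ox; apply: nx.
by apply: subset_cube_closed_cube; exact: OM.
Qed.

Lemma test_function_differentiable phi x :
  test_function Omega phi -> differentiable phi x.
Proof. by move=> [s _ _]; exact: (s [::]). Qed.

Lemma test_function_continuous phi : test_function Omega phi -> continuous phi.
Proof.
by move=> tp x; apply: differentiable_continuous; exact: test_function_differentiable.
Qed.

(** Away from the closed support of phi, phi vanishes near the point, and so does
    its partial derivative. *)
Lemma test_function_partial i phi :
  test_function Omega phi -> test_function Omega (partial i phi).
Proof.
move=> tp; have [s c sub] := tp.
have sub' : closure [set x | partial i phi x != 0] `<=`
    closure [set x | phi x != 0].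
  rewrite [X in _ `<=` X](closure_id _).1; last exact: closed_closure.
  apply: closureS => x /=; apply: contraNP => nx.
  have : nbhs x (~` closure [set x | phi x != 0]).
    by apply: open_nbhs_nbhs; split => //; apply: closed_openC; exact: closed_closure.
  move=> nb; rewrite /partial (near_eq_derive (g := cst 0)) ?derive_cst//.
  apply: filterS nb => y ny /=; apply/eqP; apply: contraT => y0; exfalso; apply: ny.
  exact: subset_closure.
split.
- move=> t x _; have := s (rcons t i) x I.
  suff -> : iter_partial (rcons t i) phi = iter_partial t (partial i phi) by [].
  by elim: t => //= j t ->.
- by apply: (subclosed_compact _ c) => //; exact: closed_closure.
- exact: subset_trans sub.
Qed.

Lemma test_function_L2 phi : test_function Omega phi -> L2 Omega phi.
Proof.
move=> tp; rewrite /L2 patch_test_function//.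
have cp := test_function_continuous tp; have [M pM] := test_function_cube tp.
have [B _ pB] := continuous_support_bounded cp pM.
exact: (Lfun2_bounded_support (continuous_measurable_rV cp) pB pM).
Qed.

End L2_inner_product.

(** * Weak derivatives and Sobolev inner products *)

(** The partial derivative of f g has integral zero, since g has bounded
    support. *)
Lemma integration_by_parts_continuous (R : realType) n (i : 'I_n)
    (f g : 'rV[R]_n -> R) (M : R) :
  (forall x, differentiable f x) -> (forall x, differentiable g x) ->
  continuous (partial i f) -> continuous (partial i g) ->
  (forall x, ~ closed_cube 0 M x -> g x = 0 /\ partial i g x = 0) ->
  \int[lebesgue_rV n]_x (f x * partial i g x) =
  - \int[lebesgue_rV n]_x (partial i f x * g x).
Proof.
move=> df dg cf' cg' g0; set mu := lebesgue_rV n.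
have cf : continuous f by move=> x; exact: differentiable_continuous.
have cg : continuous g by move=> x; exact: differentiable_continuous.
have prodE : partial i (f * g) =
    (fun x => f x * partial i g x + partial i f x * g x).
  apply/funext => x; rewrite /partial deriveM; try exact: diff_derivable.
  by rewrite -![_ *: _]/(_ * _) [X in _ + X]mulrC.
have c1 : continuous (fun x => f x * partial i g x).
  by move=> x; apply: continuousM; [exact: cf|exact: cg'].
have c2 : continuous (fun x => partial i f x * g x).
  by move=> x; apply: continuousM; [exact: cf'|exact: cg].
have s1 x : ~ closed_cube 0 M x -> f x * partial i g x = 0.
  by move=> /g0[_ ->]; rewrite mulr0.
have s2 x : ~ closed_cube 0 M x -> partial i f x * g x = 0.
  by move=> /g0[-> _]; rewrite mulr0.
have [B _ HB] : exists2 B, 0 <= B & forall x, `|partial i (f * g) x| <= B.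
  apply: (@continuous_support_bounded _ _ _ 0 M); rewrite prodE.
    by move=> x; exact: (cvgD (c1 x) (c2 x)).
  by move=> x nx; rewrite s1// s2// addr0.
have dfg x : differentiable (f * g) x by exact: differentiableM.
have fg0 x : ~ closed_cube 0 M x -> (f * g) x = 0.
  by move=> /g0[gx _]; rewrite -[LHS]/(f x * g x) gx mulr0.
have i1 := integrable_continuous_support c1 s1.
have i2 := integrable_continuous_support c2 s2.
have := integral_partial_eq0 dfg HB fg0.
by rewrite prodE RintegralD// => /eqP; rewrite addr_eq0 => /eqP.
Qed.

Lemma axpy_lt (R : realType) (a e x y : R) : 0 <= a -> 0 <= x ->
  x < e / 2 / (a + 1) -> y < e / 2 -> a * x + y < e.
Proof. by move=> a0 x0; rewrite ltr_pdivlMr ?ltr_wpDl// => hx hy; lra. Qed.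

Section sobolev_inner_products.
Context {R : realType} {n : nat} (Omega : set 'rV[R]_n).
Hypotheses (Omega_open : open Omega) (Omega_bounded : bounded_set Omega).
Local Notation mu := (@lebesgue_rV R n).
Local Notation wp := (wpartial Omega).
Implicit Types f g h u v w phi psi : 'rV[R]_n -> R.

Let sL2 := @subspace_L2 R n Omega.
Let iL2 := @semi_inner_L2 R n Omega.
Let bL2 := sip_bilinear iL2.

Lemma test_function_weak_partial i phi :
  test_function Omega phi -> is_weak_partial Omega i phi (partial i phi).
Proof.
move=> tp; apply/is_weak_partialE => psi ts.
have tp' := test_function_partial i tp; have ts' := test_function_partial i ts.
rewrite /L2ip !patch_test_function//.
have [M sM] := test_function_cube Omega_bounded ts.
have [M' sM'] := test_function_cube Omega_bounded ts'.
apply: (@integration_by_parts_continuous _ _ _ _ _ (Num.max M M')).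
- by move=> x; exact: test_function_differentiable tp.
- by move=> x; exact: test_function_differentiable ts.
- exact: test_function_continuous tp'.
- exact: test_function_continuous ts'.
- move=> x nx; split; [apply: sM|apply: sM']; apply: contra_not nx => cx j;
    by rewrite le_max cx ?orbT.
Qed.

Lemma test_function_H1 phi : test_function Omega phi -> H1 Omega phi.
Proof.
move=> tp; split; first exact: test_function_L2.
move=> i; exists (partial i phi); split; last exact: test_function_weak_partial.
by apply: test_function_L2 => //; exact: test_function_partial.
Qed.

(** The weak derivative wpartial is a chosen one. This is the only way by which
    it is computed: any other weak derivative can replace it in inner products. *)
Lemma wpartial_unique i u g : H1 Omega u -> L2 Omega g ->
  is_weak_partial Omega i u g ->
  forall h, L2 Omega h -> L2ip Omega (wp i u) h = L2ip Omega g h.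
Proof.
move=> hu g2 wg h h2; have [p2 wpu] := wpartialP i hu.
have Ng2 : L2 Omega (- g) by exact: subspaceN.
apply/eqP; rewrite -subr_eq0 -(bilNl bL2)// -(bilDl bL2)//; apply/eqP.
apply: weakly_zero => //; first exact: subspaceD.
move=> phi tp; have phi2 := test_function_L2 Omega_bounded tp.
rewrite (bilDl bL2)// (bilNl bL2)//.
have /is_weak_partialE/(_ phi tp) := wpu.
have /is_weak_partialE/(_ phi tp) := wg.
by move=> -> /oppr_inj ->; rewrite subrr.
Qed.

Lemma weak_partial_axpy i (a : R) u v g h :
  L2 Omega u -> L2 Omega v -> L2 Omega g -> L2 Omega h ->
  is_weak_partial Omega i u g -> is_weak_partial Omega i v h ->
  is_weak_partial Omega i (a *: u + v) (a *: g + h).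
Proof.
move=> u2 v2 g2 h2 /is_weak_partialE wu /is_weak_partialE wv.
apply/is_weak_partialE => phi tp.
have phi2 := test_function_L2 Omega_bounded tp.
have dphi2 := test_function_L2 Omega_bounded (test_function_partial i tp).
rewrite !(bilDl bL2)//; try exact: subspaceZ.
by rewrite !(bilZl bL2)// wu// wv// opprD mulrN.
Qed.

Lemma subspace_H1 : subspace (H1 Omega).
Proof.
have [L0 Lax] := sL2; split=> [|a u v hu hv].
  split=> // i; exists 0; split=> //; apply/is_weak_partialE => phi tp.
  have phi2 := test_function_L2 Omega_bounded tp.
  have dphi2 := test_function_L2 Omega_bounded (test_function_partial i tp).
  by rewrite -(scale0r 0) !(bilZl bL2)// !mul0r oppr0.
have [u2 _] := hu; have [v2 _] := hv; split; first exact: Lax.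
move=> i; have [pu wu] := wpartialP i hu; have [pv wv] := wpartialP i hv.
exists (a *: wp i u + wp i v); split; first exact: Lax.
exact: weak_partial_axpy.
Qed.

Lemma L2ip_wpartial_axpy i (a : R) u v h :
  H1 Omega u -> H1 Omega v -> L2 Omega h ->
  L2ip Omega (wp i (a *: u + v)) h =
  a * L2ip Omega (wp i u) h + L2ip Omega (wp i v) h.
Proof.
move=> hu hv h2; have [u2 _] := hu; have [v2 _] := hv.
have [pu wu] := wpartialP i hu; have [pv wv] := wpartialP i hv.
rewrite (@wpartial_unique i _ (a *: wp i u + wp i v))//.
- by rewrite (bilDl bL2) ?(bilZl bL2)//; exact: subspaceZ.
- by have [_] := subspace_H1; apply.
- by have [_] := sL2; apply.
- exact: weak_partial_axpy.
Qed.

Definition gradip u v : R := \sum_(i < n) L2ip Omega (wp i u) (wp i v).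

Lemma semi_inner_grad : semi_inner_on (H1 Omega) gradip.
Proof.
have W i u : H1 Omega u -> L2 Omega (wp i u) by move=> /(wpartialP i)[].
apply: semi_inner_of_left; first exact: subspace_H1.
- move=> u v hu hv; rewrite /gradip; apply: eq_bigr => i _.
  by rewrite (sipC iL2)//; exact: W.
- move=> a u v w hu hv hw; rewrite /gradip mulr_sumr -big_split /=.
  by apply: eq_bigr => i _; rewrite L2ip_wpartial_axpy//; exact: W.
- by move=> u hu; apply: sumr_ge0 => i _; apply: (sip_ge0 iL2); exact: W.
Qed.

Lemma gradnormE u : H1 Omega u -> gradnorm Omega u = Num.sqrt (gradip u u).
Proof.
move=> hu; congr Num.sqrt; apply: eq_bigr => i _.
by rewrite L2norm_sqr//; have [] := wpartialP i hu.
Qed.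

Lemma gradnorm_sqr u : H1 Omega u -> gradnorm Omega u ^+ 2 = gradip u u.
Proof.
by move=> hu; rewrite gradnormE// sqr_sqrtr//; exact: (sip_ge0 semi_inner_grad).
Qed.

Lemma L2norm_wpartial_le i u : L2norm Omega (wp i u) <= gradnorm Omega u.
Proof.
rewrite -[leLHS]ger0_norm ?L2norm_ge0// -sqrtr_sqr ler_sqrt; last first.
  by apply: sumr_ge0 => j _; rewrite sqr_ge0.
by rewrite (bigD1 i)//= lerDl; apply: sumr_ge0 => j _; rewrite sqr_ge0.
Qed.

Definition H1ip u v : R := L2ip Omega u v + gradip u v.

Lemma semi_inner_H1 : semi_inner_on (H1 Omega) H1ip.
Proof.
have H u : H1 Omega u -> L2 Omega u by case.
apply: semi_inner_of_left; first exact: subspace_H1.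
- move=> u v hu hv; rewrite /H1ip.
  rewrite [L2ip _ u v](sipC iL2 (H _ hu) (H _ hv)).
  by rewrite [gradip u v](sipC semi_inner_grad hu hv).
- move=> a u v w hu hv hw; have bg := sip_bilinear semi_inner_grad.
  have au := subspaceZ a subspace_H1 hu.
  rewrite /H1ip (bilDl bL2 (H _ au) (H _ hv) (H _ hw)).
  rewrite (bilZl bL2 a (H _ hu) (H _ hw)).
  rewrite (bilDl bg au hv hw) (bilZl bg a hu hw).
  by rewrite mulrDr addrACA.
- move=> u hu; apply: addr_ge0; last exact: (sip_ge0 semi_inner_grad).
  by apply: (sip_ge0 iL2); exact: H.
Qed.

Lemma H1normE u : H1 Omega u -> H1norm Omega u = Num.sqrt (H1ip u u).
Proof. by move=> hu; rewrite /H1norm L2norm_sqr ?gradnorm_sqr//; case: hu. Qed.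

Lemma L2norm_le_H1norm u : L2norm Omega u <= H1norm Omega u.
Proof.
rewrite -[leLHS]ger0_norm ?L2norm_ge0// -sqrtr_sqr ler_sqrt ?addr_ge0 ?sqr_ge0//.
by rewrite lerDl sqr_ge0.
Qed.

Lemma gradnorm_le_H1norm u : gradnorm Omega u <= H1norm Omega u.
Proof.
rewrite -[leLHS]ger0_norm ?sqrtr_ge0// -sqrtr_sqr ler_sqrt ?addr_ge0 ?sqr_ge0//.
by rewrite lerDr sqr_ge0.
Qed.

Lemma iter_partial_axpy (a : R) f g s :
  smooth_on setT f -> smooth_on setT g ->
  iter_partial s (a *: f + g) = a *: iter_partial s f + iter_partial s g.
Proof.
move=> sf sg; elim: s => //= i s ->; apply/funext => x.
have df : derivable (iter_partial s f) x (delta_mx 0 i).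
  by apply: diff_derivable; exact: sf.
have dg : derivable (iter_partial s g) x (delta_mx 0 i).
  by apply: diff_derivable; exact: sg.
by rewrite /partial deriveD ?deriveZ//; exact: derivableZ.
Qed.

Lemma subspace_test_function : subspace (test_function Omega).
Proof.
split=> [|a f g tf tg].
  have e : [set x : 'rV[R]_n | (0 : 'rV[R]_n -> R) x != 0] = set0.
    by apply/seteqP; split => x //=; rewrite eqxx.
  split; rewrite ?e ?closure0//; last exact: compact0.
  have := @smooth_term_smooth R n (cst 0) (SmoothCst 0); exact.
have [sf cf ff] := tf; have [sg cg gg] := tg.
have sub : closure [set x | (a *: f + g) x != 0] `<=`
    closure [set x | f x != 0] `|` closure [set x | g x != 0].
  rewrite -closureU; apply: closureS => x /=.
  rewrite -[(_ + _) x]/(a * f x + g x) => h.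
  have [fx|fx] := eqVneq (f x) 0; last by left.
  by right; move: h; rewrite fx mulr0 add0r.
split.
- move=> s x _; rewrite iter_partial_axpy//.
  by apply: differentiableD; [apply: differentiableZ; exact: sf|exact: sg].
- apply: (subclosed_compact _ (compactU cf cg)) => //; exact: closed_closure.
- by apply: (subset_trans sub) => x [/ff|/gg].
Qed.

(** Approximate a u + v by the same combination of test functions. *)
Lemma subspace_H10 : subspace (H10 Omega).
Proof.
have [t0 tax] := subspace_test_function; have sH1 := subspace_H1.
have bH := sip_bilinear semi_inner_H1.
have [H10' Hax] := sH1.
split=> [|a u v [hu Hu] [hv Hv]].
  split=> // e e0; exists 0 => //; rewrite subr0 H1normE//.
  by have := bilZl bH 0 H10' H10'; rewrite scale0r mul0r => ->; rewrite sqrtr0.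
split=> [|e e0]; first exact: Hax.
have e1 : 0 < e / 2 / (`|a| + 1) by rewrite !divr_gt0// ltr_wpDl.
have [phi tphi h1] := Hu _ e1.
have [psi tpsi h2] := Hv _ (divr_gt0 e0 (ltr0n R 2)).
exists (a *: phi + psi); first exact: tax.
have hphi := test_function_H1 tphi; have hpsi := test_function_H1 tpsi.
have -> : a *: u + v - (a *: phi + psi) = a *: (u - phi) + (v - psi).
  by rewrite scalerBr opprD addrACA.
have Hup : H1 Omega (u - phi) by exact: subspaceB.
have Hvp : H1 Omega (v - psi) by exact: subspaceB.
have Haup := subspaceZ a sH1 Hup.
rewrite H1normE; last exact: subspaceD.
apply: (le_lt_trans (sip_triangle semi_inner_H1 Haup Hvp)).
rewrite (bilZl bH)// (bilZr bH)// mulrA -expr2 sqrtrM ?sqr_ge0// sqrtr_sqr.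
rewrite (H1normE Hup) in h1; rewrite (H1normE Hvp) in h2.
apply: (axpy_lt _ _ h1 h2); [exact: normr_ge0|exact: sqrtr_ge0].
Qed.

End sobolev_inner_products.

(** * Green's identity and Poincare's inequality *)

Lemma le0_eps (R : realType) (x c : R) : 0 <= c ->
  (forall e, 0 < e -> x <= c * e) -> x <= 0.
Proof.
move=> c0 h; apply/ler_addgt0Pr => e e0; rewrite add0r.
have c1 : 0 < c + 1 by rewrite ltr_wpDl.
have := h (e / (c + 1)) (divr_gt0 e0 c1); move=> /le_trans; apply.
by rewrite mulrA ler_pdivrMr// mulrDr mulr1 [e * c]mulrC lerDl ltW.
Qed.

Lemma triangle_chain (R : realType) (m a b c d g h k e : R) : 0 <= m ->
  a <= c + b -> d <= h + g -> c <= k -> h <= k -> b <= 2 * m * d -> k < e ->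
  a - 2 * m * g <= (1 + 2 * m) * e.
Proof.
move=> m0 h1 h2 h3 h4 h5 h6.
have h7 : m * d <= m * (h + g) by rewrite ler_wpM2l.
have h8 : m * h <= m * k by rewrite ler_wpM2l.
have h9 : m * k <= m * e by rewrite ler_wpM2l// ltW.
lra.
Qed.

Section green_poincare.
Context {R : realType} {n : nat} (Omega : set 'rV[R]_n).
Hypotheses (Omega_open : open Omega) (Omega_bounded : bounded_set Omega).
Local Notation mu := (@lebesgue_rV R n).
Local Notation wp := (wpartial Omega).
Implicit Types f g h u v w phi psi : 'rV[R]_n -> R.

Let sL2 := @subspace_L2 R n Omega.
Let iL2 := @semi_inner_L2 R n Omega.
Let bL2 := sip_bilinear iL2.
Let sH1 := subspace_H1 Omega_bounded.
Let iG := semi_inner_grad Omega_open Omega_bounded.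
Let bG := sip_bilinear iG.

Lemma grad_cauchy_schwarz u v : H1 Omega u -> H1 Omega v ->
  `|gradip Omega u v| <= gradnorm Omega u * gradnorm Omega v.
Proof.
move=> hu hv.
rewrite (gradnormE hu) (gradnormE hv); exact: (sip_cauchy_schwarz iG hu hv).
Qed.

Lemma laplacian_L2 u : H2 Omega u -> L2 Omega (laplacian Omega u).
Proof.
move=> [_ hu]; apply: (big_ind (L2 Omega)); first by case: sL2.
  by move=> f g; exact: subspaceD.
by move=> i _; have [] := wpartialP i (hu i).
Qed.

Lemma L2ip_laplacian u h : H2 Omega u -> L2 Omega h ->
  L2ip Omega (laplacian Omega u) h =
  \sum_(i < n) L2ip Omega (wp i (wp i u)) h.
Proof.
move=> [_ hu] h2; have W i : L2 Omega (wp i (wp i u)).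
  by have [] := wpartialP i (hu i).
rewrite /laplacian.
suff : forall r : seq 'I_n, L2 Omega (\sum_(i <- r) wp i (wp i u)) /\
    L2ip Omega (\sum_(i <- r) wp i (wp i u)) h =
    \sum_(i <- r) L2ip Omega (wp i (wp i u)) h by move=> /(_ (index_enum _))[].
elim=> [|i r [IH1 IH2]].
  have [L0 _] := sL2; rewrite !big_nil; split => //.
  by have := bilZl bL2 0 L0 h2; rewrite scale0r mul0r.
rewrite !big_cons; split; first exact: (subspaceD sL2 (W i) IH1).
by rewrite (bilDl bL2 (W i) IH1 h2) IH2.
Qed.

(** For a test function this is the definition of the weak derivatives of the
    components of grad u. Both sides are continuous in w for the H1 norm. *)
Lemma green_identity u w : H2 Omega u -> H10 Omega w ->
  L2ip Omega (laplacian Omega u) w = - gradip Omega u w.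
Proof.
move=> Hu [Hw Hwe]; have [hu hui] := Hu; have [w2 _] := Hw.
have lap2 := laplacian_L2 Hu.
have test phi : test_function Omega phi ->
    L2ip Omega (laplacian Omega u) phi = - gradip Omega u phi.
  move=> tp; have phi2 := test_function_L2 Omega_bounded tp.
  have hphi := test_function_H1 Omega_bounded tp.
  rewrite (L2ip_laplacian Hu phi2) /gradip -sumrN; apply: eq_bigr => i _.
  have [_ /is_weak_partialE/(_ phi tp) e] := wpartialP i (hui i).
  apply/eqP; rewrite -eqr_oppLR -e; apply/eqP.
  have dphi2 := test_function_L2 Omega_bounded (test_function_partial i tp).
  have [pu _] := wpartialP i hu; have [pphi _] := wpartialP i hphi.
  rewrite (sipC iL2 pu dphi2) (sipC iL2 pu pphi).
  by rewrite (wpartial_unique Omega_open Omega_bounded hphi dphi2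
    (test_function_weak_partial Omega_bounded i tp)).
apply/eqP; rewrite -subr_eq0 opprK -normr_le0; apply/eqP.
apply/eqP; apply: (@le0_eps _ _ (L2norm Omega (laplacian Omega u) + gradnorm Omega u)).
  by rewrite addr_ge0 ?L2norm_ge0// sqrtr_ge0.
move=> e e0; have [phi tp he] := Hwe e e0.
have phi2 := test_function_L2 Omega_bounded tp.
have hphi := test_function_H1 Omega_bounded tp.
have wphi2 := subspaceB sL2 w2 phi2; have Hwphi := subspaceB sH1 Hw hphi.
have -> : L2ip Omega (laplacian Omega u) w + gradip Omega u w =
   L2ip Omega (laplacian Omega u) (w - phi) + gradip Omega u (w - phi).
  rewrite (bilDr bL2 lap2 w2 (subspaceN sL2 phi2)) (bilNr bL2 lap2 phi2).
  rewrite (bilDr bG hu Hw (subspaceN sH1 hphi)) (bilNr bG hu hphi) (test _ tp).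
  by rewrite opprK addrACA subrr addr0.
apply: (le_trans (ler_normD _ _)); rewrite mulrDl; apply: lerD.
  apply: (le_trans (L2_cauchy_schwarz lap2 wphi2)).
  apply: ler_wpM2l; first exact: L2norm_ge0.
  by apply: ltW; apply: le_lt_trans he; exact: L2norm_le_H1norm.
apply: (le_trans (grad_cauchy_schwarz hu Hwphi)).
apply: ler_wpM2l; first exact: sqrtr_ge0.
by apply: ltW; apply: le_lt_trans he; exact: gradnorm_le_H1norm.
Qed.

(** Since the partial derivative of x_i is 1, integrating by parts gives
    int phi ^ 2 = - int x_i 2 phi d_i phi, and pointwise
    - 2 x_i phi d_i phi <= phi ^ 2 / 2 + 2 M ^ 2 (d_i phi) ^ 2. *)
Lemma poincare_test_function (i : 'I_n) (M : R) phi :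
  (forall x, Omega x -> `|x 0 i| <= M) -> test_function Omega phi ->
  \int[mu]_x (phi x * phi x) <=
  4 * M ^+ 2 * \int[mu]_x (partial i phi x * partial i phi x).
Proof.
move=> OM tp; have tp' := test_function_partial i tp.
have [C sC] := test_function_cube Omega_bounded tp.
have [C' sC'] := test_function_cube Omega_bounded tp'.
have cp := test_function_continuous tp; have cp' := test_function_continuous tp'.
have dp x := test_function_differentiable x tp.
pose X (x : 'rV[R]_n) : R := x 0 i.
have dX x : differentiable X x by exact: differentiable_coord.
have pX : partial i X = cst 1.
  apply/funext => x; rewrite /partial /derive; apply: cvg_lim => //.
  apply: cvg_near_cst.
  have nz : \forall h \near (0 : R)^', h != 0 by exact: nbhs_dnbhs_neq.
  apply: filterS nz => h h0; rewrite /= /shift /X !mxE !eqxx/= addrK.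
  by rewrite -[_ *: _]/(_ * _) mulr1 mulVf.
have pp : partial i (phi * phi) = (fun x => 2 * (phi x * partial i phi x)).
  apply/funext => x; rewrite /partial deriveM; try exact: diff_derivable.
  by rewrite -![_ *: _]/(_ * _); ring.
have cpp : continuous (fun x => phi x * partial i phi x).
  by move=> x; apply: continuousM; [exact: cp|exact: cp'].
have E : \int[mu]_x (X x * partial i (phi * phi) x) =
    - \int[mu]_x (partial i X x * (phi * phi) x).
  apply: (@integration_by_parts_continuous _ _ _ _ _ (Num.max C C')) => //.
  - by move=> x; exact: differentiableM.
  - by rewrite pX; exact: cst_continuous.
  - rewrite pp => x; exact: (cvgMr (cpp x)).
  - move=> x nx; have p0 : phi x = 0.
      by apply: sC; apply: contra_not nx => cx j; rewrite le_max cx.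
    by rewrite pp -[(phi * phi) x]/(phi x * phi x) p0 !mul0r mulr0.
have int_mul (f g : 'rV[R]_n -> R) : continuous f -> continuous g ->
    (forall x, ~ closed_cube 0 C x -> f x = 0) ->
    mu.-integrable setT (EFin \o (fun x => f x * g x)).
  move=> cf cg f0; apply: (@integrable_continuous_support _ _ _ 0 C).
    by move=> x; apply: continuousM; [exact: cf|exact: cg].
  by move=> x /f0 ->; rewrite mul0r.
have i1 := int_mul phi phi cp cp sC.
have i2 : mu.-integrable setT (EFin \o (fun x => partial i phi x * partial i phi x)).
  apply: (@integrable_continuous_support _ _ _ 0 C').
    by move=> x; apply: continuousM; exact: cp'.
  by move=> x /sC' ->; rewrite mul0r.
have i3 : mu.-integrable setT (EFin \o (fun x => X x * (2 * (phi x * partial i phi x)))).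
  apply: (@integrable_continuous_support _ _ _ 0 C).
    move=> x; apply: continuousM; first exact: differentiable_continuous.
    exact: (cvgMr (cpp x)).
  by move=> x /sC ->; rewrite mul0r !mulr0.
have i1' := integrableZl measurableT (2^-1) i1.
have i2' := integrableZl measurableT (2 * M ^+ 2) i2.
have i12 := integrableD measurableT i1' i2'.
have i3' := integrableN i3.
have E' : \int[mu]_x (phi x * phi x) =
    \int[mu]_x (- (X x * (2 * (phi x * partial i phi x)))).
  move: E; rewrite pp => E.
  transitivity (- \int[mu]_x (X x * (2 * (phi x * partial i phi x)))).
    by rewrite E opprK pX; apply: eq_Rintegral => x _; rewrite mul1r.
  by rewrite -mulN1r -RintegralZl//; apply: eq_Rintegral => x _; rewrite mulN1r.
have : \int[mu]_x (- (X x * (2 * (phi x * partial i phi x)))) <=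
   \int[mu]_x (2^-1 * (phi x * phi x) + 2 * M ^+ 2 * (partial i phi x * partial i phi x)).
  apply: le_Rintegral => // x _.
  have [Ox|nx] := pselect (Omega x); last first.
    rewrite (test_function_support tp nx) (test_function_support tp' nx).
    by rewrite !mul0r !mulr0 oppr0 addr0.
  have := OM x Ox; rewrite -/(X x).
  move: (X x) (phi x) (partial i phi x) => a b c.
  rewrite -(ler_pXn2r (n := 2)) ?nnegrE ?normr_ge0//; last first.
    exact: le_trans (OM x Ox).
  rewrite -normrX ger0_norm ?sqr_ge0// => aM.
  have h1 : a ^+ 2 * c ^+ 2 <= M ^+ 2 * c ^+ 2 by rewrite ler_wpM2r ?sqr_ge0.
  have := sqr_ge0 (b / 2 + a * c) ; nra.
rewrite RintegralD// !RintegralZl// -E'.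
move: (\int[mu]_x _) (\int[mu]_x _) => a b; lra.
Qed.

Lemma poincare (i : 'I_n) : exists2 c, 0 <= c &
  forall u, H10 Omega u -> L2norm Omega u <= c * gradnorm Omega u.
Proof.
have [M OM] := bounded_set_sub_cube Omega_bounded.
have OM' x : Omega x -> `|x 0 i| <= `|M|.
  move=> /OM/(_ i); rewrite mxE subr0 => /ltW/le_trans; apply; exact: ler_norm.
exists (2 * `|M|); first by rewrite mulr_ge0.
have test phi : test_function Omega phi ->
    L2norm Omega phi <= 2 * `|M| * gradnorm Omega phi.
  move=> tp; have phi2 := test_function_L2 Omega_bounded tp.
  have tp' := test_function_partial i tp.
  have phi2' := test_function_L2 Omega_bounded tp'.
  have hphi := test_function_H1 Omega_bounded tp.
  have e : L2norm Omega (partial i phi) <= gradnorm Omega phi.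
    apply: le_trans (L2norm_wpartial_le Omega i phi).
    have [p2 _] := wpartialP i hphi.
    have w h := wpartial_unique Omega_open Omega_bounded hphi phi2'
      (test_function_weak_partial Omega_bounded i tp) (h := h).
    rewrite (L2normE phi2') (L2normE p2) (w _ p2) (sipC iL2 phi2' p2) (w _ phi2').
    exact: lexx.
  apply: (@le_trans _ _ (2 * `|M| * L2norm Omega (partial i phi))); last first.
    by apply: ler_wpM2l => //; rewrite mulr_ge0.
  rewrite -(ler_pXn2r (n := 2)) ?nnegrE ?mulr_ge0 ?L2norm_ge0//.
  rewrite exprMn (L2norm_sqr phi2) (L2norm_sqr phi2') /L2ip.
  rewrite (patch_test_function tp) (patch_test_function tp').
  have := poincare_test_function OM' tp; rewrite exprMn.
  by have -> : (2 : R) ^+ 2 = 4 by ring.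
move=> u [hu hue]; rewrite -subr_le0; have [u2 _] := hu.
apply: (@le0_eps _ _ (1 + 2 * `|M|)) => [|e e0]; first by rewrite addr_ge0// mulr_ge0.
have [phi tp he] := hue e e0.
have phi2 := test_function_L2 Omega_bounded tp.
have hphi := test_function_H1 Omega_bounded tp.
have uphi2 := subspaceB sL2 u2 phi2; have Huphi := subspaceB sH1 hu hphi.
have phiu := subspaceB sH1 hphi hu.
have t1 : L2norm Omega u <= L2norm Omega (u - phi) + L2norm Omega phi.
  have := sip_triangle iL2 uphi2 phi2; rewrite subrK.
  by rewrite -(L2normE u2) -(L2normE uphi2) -(L2normE phi2).
have t2 : gradnorm Omega phi <= gradnorm Omega (u - phi) + gradnorm Omega u.
  have := sip_triangle iG phiu hu; rewrite subrK.
  rewrite (gradnormE Huphi) (gradnormE hu) (gradnormE hphi).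
  have -> : gradip Omega (phi - u) (phi - u) = gradip Omega (u - phi) (u - phi).
    by rewrite -opprB (bilNl bG Huphi (subspaceN sH1 Huphi)) (bilNr bG Huphi Huphi) opprK.
  exact.
have t3 := L2norm_le_H1norm Omega (u - phi).
have t4 := gradnorm_le_H1norm Omega (u - phi).
have t5 := test phi tp; have M0 := normr_ge0 M.
exact: (triangle_chain M0 t1 t2 t3 t4 t5 he).
Qed.

End green_poincare.

(** * Elementary inequalities for the weighted energy *)

(** With x = 1 + t, p = || grad u || ^ 2 and q = || u_t || ^ 2 the left-hand side is
    - 2 x p + 4 x q - x ^ 2 a ^ 4 + 3 G - 3 x a ^ 2 g, minus the constant. Three
    completed squares, each spending a quarter of x ^ 2 a ^ 4, bound
    4 x c ^ 2 a ^ 2 by a constant, 3 x a ^ 3 sqrt p by 9 a ^ 2 p, and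
    9 a ^ 2 p by 81 p ^ 2. *)
Lemma decay_rate_le0 (R : realType) (c E0 x a p q y G g : R) :
  0 <= c -> 1 <= x -> 0 <= a -> 0 <= y -> p = y ^+ 2 -> 0 <= q -> p <= 2 * E0 ->
  q <= c ^+ 2 * a ^+ 2 -> G <= c * E0 -> - g <= a * y ->
  2 * x * (2^-1 * (p + q)) + x ^+ 2 * - (a ^+ 2 * a ^+ 2) +
    (3 * G + 3 * x * (q - p - a ^+ 2 * g))
    - (16 * c ^+ 4 + 324 * E0 ^+ 2 + 3 * c * E0) <= 0.
Proof.
move=> c0 x1 a0 y0 pE q0 pE0 qa GE gay.
have p0 : 0 <= p by rewrite pE sqr_ge0.
have x0 : 0 <= x by apply: le_trans x1.
have xp0 : 0 <= x * p by rewrite mulr_ge0.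
have xq : x * q <= x * (c ^+ 2 * a ^+ 2) by rewrite ler_wpM2l.
have h1 : 4 * (x * (c ^+ 2 * a ^+ 2)) <= 4^-1 * (x ^+ 2 * a ^+ 4) + 16 * c ^+ 4.
  rewrite -subr_ge0.
  have -> : 4^-1 * (x ^+ 2 * a ^+ 4) + 16 * c ^+ 4 - 4 * (x * (c ^+ 2 * a ^+ 2)) =
    (2^-1 * (x * a ^+ 2) - 4 * c ^+ 2) ^+ 2 by field.
  exact: sqr_ge0.
have xa0 : 0 <= x * a ^+ 2 by rewrite mulr_ge0// sqr_ge0.
have h2 : x * a ^+ 2 * - g <= x * a ^+ 2 * (a * y) by rewrite ler_wpM2l.
have h3 : 3 * (x * a ^+ 2 * (a * y)) <= 4^-1 * (x ^+ 2 * a ^+ 4) + 9 * (a ^+ 2 * p).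
  rewrite -subr_ge0.
  have -> : 4^-1 * (x ^+ 2 * a ^+ 4) + 9 * (a ^+ 2 * p) - 3 * (x * a ^+ 2 * (a * y)) =
    (2^-1 * (x * a ^+ 2) - 3 * (a * y)) ^+ 2 by rewrite pE; field.
  exact: sqr_ge0.
have h4 : 9 * (a ^+ 2 * p) <= 4^-1 * a ^+ 4 + 81 * p ^+ 2.
  rewrite -subr_ge0.
  have -> : 4^-1 * a ^+ 4 + 81 * p ^+ 2 - 9 * (a ^+ 2 * p) =
    (2^-1 * a ^+ 2 - 9 * p) ^+ 2 by field.
  exact: sqr_ge0.
have h5 : p ^+ 2 <= 4 * E0 ^+ 2.
  have -> : 4 * E0 ^+ 2 = (2 * E0) ^+ 2 by ring.
  by rewrite ler_pXn2r// nnegrE// (le_trans p0).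
have a4 : 0 <= a ^+ 4 by rewrite exprn_ge0.
have h6 : a ^+ 4 <= x ^+ 2 * a ^+ 4.
  by rewrite ler_peMl// exprn_ege1.
have -> : a ^+ 2 * a ^+ 2 = a ^+ 4 by ring.
have e1 : 2 * x * (2^-1 * (p + q)) = x * p + x * q by field.
have e2 : x ^+ 2 * - a ^+ 4 = - (x ^+ 2 * a ^+ 4) by ring.
have e3 : 3 * x * (q - p - a ^+ 2 * g) =
    3 * (x * q) - 3 * (x * p) + 3 * (x * a ^+ 2 * - g) by ring.
have e4 : 3 * c * E0 = 3 * (c * E0) by ring.
rewrite e1 e2 e3 e4; lra.
Qed.

Lemma weighted_energy_lipschitz (R : realType) (K c E0 M X s t d es et Gs Gt : R) :
  0 <= K -> 0 <= c -> 0 <= E0 -> 0 <= M -> 0 <= s -> s <= t -> 1 + t <= X ->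
  0 <= d -> `|es| <= E0 -> `|Gs| <= c * E0 ->
  `|et - es| <= M * d -> `|Gt - Gs| <= 2 * c * M * d ->
  (1 + t) ^+ 2 * et + 3 * (1 + t) * Gt - K * t -
  ((1 + s) ^+ 2 * es + 3 * (1 + s) * Gs - K * s) <=
  (X ^+ 2 * M + 6 * X * c * M + 2 * X * E0 + 3 * c * E0 + K) * (d + (t - s)).
Proof.
move=> K0 c0 E00 M0 s0 st tX d0 esE GsE He HG.
have X0 : 0 <= X by lra.
have ts0 : 0 <= t - s by lra.
have he : et - es <= M * d by apply: le_trans He; exact: ler_norm.
have hG : Gt - Gs <= 2 * c * M * d by apply: le_trans HG; exact: ler_norm.
have es' : es <= E0 by apply: le_trans esE; exact: ler_norm.
have Gs' : Gs <= c * E0 by apply: le_trans GsE; exact: ler_norm.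
have Md : 0 <= M * d by rewrite mulr_ge0.
have cMd : 0 <= 2 * c * M * d by rewrite !mulr_ge0.
have -> : (1 + t) ^+ 2 * et + 3 * (1 + t) * Gt - K * t -
    ((1 + s) ^+ 2 * es + 3 * (1 + s) * Gs - K * s) =
  (1 + t) ^+ 2 * (et - es) + ((1 + t) + (1 + s)) * (t - s) * es +
  3 * (1 + t) * (Gt - Gs) + 3 * (t - s) * Gs - K * (t - s) by ring.
have h1 : (1 + t) ^+ 2 * (et - es) <= X ^+ 2 * (M * d).
  apply: (@le_trans _ _ ((1 + t) ^+ 2 * (M * d))).
    by rewrite ler_wpM2l ?sqr_ge0.
  by rewrite ler_wpM2r// ler_pXn2r// nnegrE; lra.
have h2 : ((1 + t) + (1 + s)) * (t - s) * es <= 2 * X * (t - s) * E0.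
  apply: (@le_trans _ _ (((1 + t) + (1 + s)) * (t - s) * E0)).
    by apply: ler_wpM2l => //; rewrite mulr_ge0//; lra.
  by apply: ler_wpM2r => //; apply: ler_wpM2r => //; lra.
have h3 : 3 * (1 + t) * (Gt - Gs) <= 3 * X * (2 * c * M * d).
  apply: (@le_trans _ _ (3 * (1 + t) * (2 * c * M * d))).
    by apply: ler_wpM2l => //; lra.
  by apply: ler_wpM2r => //; lra.
have h4 : 3 * (t - s) * Gs <= 3 * (t - s) * (c * E0).
  by apply: ler_wpM2l => //; lra.
have h5 : 0 <= K * (t - s) by rewrite mulr_ge0.
have k1 : 0 <= (X ^+ 2 * M + 6 * X * c * M) * (t - s).
  by apply: mulr_ge0 => //; apply: addr_ge0; rewrite !mulr_ge0 ?sqr_ge0.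
have k2 : 0 <= (2 * X * E0 + 3 * c * E0 + K) * d.
  by rewrite mulr_ge0// !addr_ge0 ?mulr_ge0.
have e1 : (X ^+ 2 * M + 6 * X * c * M + 2 * X * E0 + 3 * c * E0 + K) * (d + (t - s))
  = X ^+ 2 * (M * d) + 3 * X * (2 * c * M * d) + 2 * X * (t - s) * E0 +
    3 * (t - s) * (c * E0) + K * (t - s) +
    (X ^+ 2 * M + 6 * X * c * M) * (t - s) + (2 * X * E0 + 3 * c * E0 + K) * d.
  by ring.
rewrite e1; lra.
Qed.

(* Only the algebraic properties of these are used from here on. *)
(** * The energy space *)

#[local] Opaque L2ip gradip L2norm gradnorm laplacian wpartial.

Lemma axpy_addE (R : realType) (a g1 g2 l1 l2 : R) :
  a * g1 + g2 + (a * l1 + l2) = a * (g1 + l1) + (g2 + l2).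
Proof. by rewrite mulrDr addrACA. Qed.

Lemma addr_opp_subst (R : realType) (a x y y' z b d : R) :
  z = x + y' -> y' = a * y -> x = - b -> y = - d -> z = - b - a * d.
Proof. by move=> -> -> -> ->; rewrite mulrN. Qed.

Section energy_space.
Context {R : realType} {n : nat} (Omega : set 'rV[R]_n).
Hypotheses (Omega_open : open Omega) (Omega_bounded : bounded_set Omega).
Local Notation state := (('rV[R]_n -> R) * ('rV[R]_n -> R))%type.
Implicit Types (w z : state) (U : R -> state).

Let sL2 := @subspace_L2 R n Omega.
Let iL2 := @semi_inner_L2 R n Omega.
Let bL2 := sip_bilinear iL2.
Let sH10 := subspace_H10 Omega_open Omega_bounded.
Let iG := semi_inner_grad Omega_open Omega_bounded.
Let bG := sip_bilinear iG.

Definition energy_ip w z : R := gradip Omega w.1 z.1 + L2ip Omega w.2 z.2.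

(** A bilinear but not symmetric form, whose quadratic form at (u, v) is
    the cross term < u, v >. *)
Definition cross_ip w z : R := L2ip Omega w.1 z.2.

Lemma subspace_energy_space : subspace (energy_space Omega).
Proof.
have [H0 Hax] := sH10; have [L0 Lax] := sL2.
split=> [|a w z [w1 w2] [z1 z2]]; first by split.
by split; [exact: (Hax a w.1 z.1 w1 z1)|exact: (Lax a w.2 z.2 w2 z2)].
Qed.

Lemma semi_inner_energy : semi_inner_on (energy_space Omega) energy_ip.
Proof.
apply: semi_inner_of_left; first exact: subspace_energy_space.
- move=> w z [[w1 _] w2] [[z1 _] z2]; rewrite /energy_ip.
  by rewrite [gradip _ w.1 _](sipC iG w1 z1) [L2ip _ w.2 _](sipC iL2 w2 z2).
- move=> a w z y [[w1 _] w2] [[z1 _] z2] [[y1 _] y2]; rewrite /energy_ip /=.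
  have aw1 := subspaceZ a (bil_domain bG) w1; have aw2 := subspaceZ a sL2 w2.
  rewrite (bilDl bG aw1 z1 y1) (bilZl bG a w1 y1).
  rewrite (bilDl bL2 aw2 z2 y2) (bilZl bL2 a w2 y2); exact: axpy_addE.
- move=> w [[w1 _] w2]; apply: addr_ge0; first exact: (sip_ge0 iG w1).
  exact: (sip_ge0 iL2 w2).
Qed.

Lemma bilinear_cross : bilinear_on (energy_space Omega) cross_ip.
Proof.
split; first exact: subspace_energy_space.
- by move=> w z y [[[w1 _] _] _] [[[z1 _] _] _] [_ y2]; exact: (bilDl bL2 w1 z1 y2).
- by move=> w z y [[[w1 _] _] _] [_ z2] [_ y2]; exact: (bilDr bL2 w1 z2 y2).
- by move=> a w z [[[w1 _] _] _] [_ z2]; exact: (bilZl bL2 a w1 z2).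
- by move=> a w z [[[w1 _] _] _] [_ z2]; exact: (bilZr bL2 a w1 z2).
Qed.

Lemma energy_normE w : energy_space Omega w ->
  energy_norm Omega w = Num.sqrt (energy_ip w w).
Proof.
by move=> [[w1 _] w2]; rewrite /energy_norm (gradnorm_sqr Omega_open Omega_bounded w1)
  (L2norm_sqr w2).
Qed.

Lemma energyE w : energy_space Omega w -> energy Omega w = 2^-1 * energy_ip w w.
Proof.
by move=> [[w1 _] w2]; rewrite /energy (gradnorm_sqr Omega_open Omega_bounded w1)
  (L2norm_sqr w2).
Qed.

Lemma energy_norm_ge0 w : 0 <= energy_norm Omega w.
Proof. exact: sqrtr_ge0. Qed.

Lemma energy_ip_le w z : energy_space Omega w -> energy_space Omega z ->
  `|energy_ip w z| <= 1 * (energy_norm Omega w * energy_norm Omega z).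
Proof.
move=> hw hz; rewrite mul1r (energy_normE hw) (energy_normE hz).
exact: (sip_cauchy_schwarz semi_inner_energy hw hz).
Qed.

Lemma energy_norm_triangle w z : energy_space Omega w -> energy_space Omega z ->
  energy_norm Omega (w + z) <= energy_norm Omega w + energy_norm Omega z.
Proof.
move=> hw hz; have hwz := subspaceD subspace_energy_space hw hz.
rewrite (energy_normE hw) (energy_normE hz) (energy_normE hwz).
exact: (sip_triangle semi_inner_energy hw hz).
Qed.

Lemma gradnorm_le_energy_norm w : gradnorm Omega w.1 <= energy_norm Omega w.
Proof.
rewrite -[leLHS]ger0_norm ?sqrtr_ge0// -sqrtr_sqr ler_sqrt ?addr_ge0 ?sqr_ge0//.
by rewrite lerDl sqr_ge0.
Qed.

Lemma L2norm_le_energy_norm w : L2norm Omega w.2 <= energy_norm Omega w.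
Proof.
rewrite -[leLHS]ger0_norm ?L2norm_ge0// -sqrtr_sqr ler_sqrt ?addr_ge0 ?sqr_ge0//.
by rewrite lerDr sqr_ge0.
Qed.

Variable (c : R).
Hypothesis c_ge0 : 0 <= c.
Hypothesis c_poincare :
  forall u, H10 Omega u -> L2norm Omega u <= c * gradnorm Omega u.

(** Poincare's inequality controls the first component by its gradient. *)
Lemma cross_ip_le w z : energy_space Omega w -> energy_space Omega z ->
  `|cross_ip w z| <= c * (energy_norm Omega w * energy_norm Omega z).
Proof.
move=> [w1 w2] [z1 z2]; have [[w12 _] _] := w1.
apply: (le_trans (L2_cauchy_schwarz w12 z2)).
rewrite mulrA; apply: ler_pM; rewrite ?L2norm_ge0//; last exact: L2norm_le_energy_norm.
apply: (le_trans (c_poincare w1)); apply: ler_wpM2l => //.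
exact: gradnorm_le_energy_norm.
Qed.

Section rates.
Variable w : state.
Hypothesis w_dom : wave_domain Omega w.
Let W := - wave_op Omega w.

Lemma wave_domain_energy_space : energy_space Omega w.
Proof. by case: w_dom => -[_ w1] [[[w2 _] _] _]. Qed.

Lemma wave_op_energy_space : energy_space Omega W.
Proof.
case: w_dom => -[h1 w1] [h2 w2]; apply: (subspaceN subspace_energy_space); split => /=.
  exact: (subspaceN sH10).
apply: (subspaceB sL2); first by apply: (subspaceN sL2); exact: laplacian_L2.
by apply: (subspaceZ _ sL2); exact: laplacian_L2.
Qed.

Lemma wave_op2 : W.2 = laplacian Omega w.1 +
  gradnorm Omega w.2 ^+ 2 *: laplacian Omega w.2.
Proof. by rewrite /W /= opprD !opprK. Qed.

(** Green's identity, for u and for u_t. *)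
Lemma L2ip_wave_op2 h : H10 Omega h -> L2ip Omega h W.2 =
  - gradip Omega w.1 h - gradnorm Omega w.2 ^+ 2 * gradip Omega w.2 h.
Proof.
move=> hh; have [[h2 _] _] := hh; case: w_dom => -[h1 w1] [h2' w2].
have l1 := laplacian_L2 h1.
have l2 := laplacian_L2 h2'.
have al2 := subspaceZ (gradnorm Omega w.2 ^+ 2) sL2 l2.
have e1 := etrans (sipC iL2 h2 l1) (green_identity Omega_open Omega_bounded h1 hh).
have e2 := etrans (sipC iL2 h2 l2) (green_identity Omega_open Omega_bounded h2' hh).
have e3 := bilDr bL2 h2 l1 al2; have e4 := bilZr bL2 (gradnorm Omega w.2 ^+ 2) h2 l2.
rewrite wave_op2; exact: (addr_opp_subst e3 e4 e1 e2).
Qed.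

(** The two terms with < grad u, grad v > cancel: the linear wave part of the
    equation is conservative. *)
Lemma energy_rate : energy_ip W w + energy_ip w W =
  2 * - (gradnorm Omega w.2 ^+ 2 * gradnorm Omega w.2 ^+ 2).
Proof.
have hw := wave_domain_energy_space; have hW := wave_op_energy_space.
rewrite (sipC semi_inner_energy hW hw).
case: w_dom => -[h1 [w1 _]] [h2' w2]; have [w21 _] := w2.
have -> : energy_ip w W = - (gradnorm Omega w.2 ^+ 2 * gradnorm Omega w.2 ^+ 2).
  rewrite /energy_ip (L2ip_wave_op2 w2) (_ : W.1 = w.2); last by rewrite /W /= opprK.
  rewrite -(gradnorm_sqr Omega_open Omega_bounded w21).
  by rewrite addrA subrr add0r.
by rewrite mulr_natl mulr2n.
Qed.

Lemma cross_rate : cross_ip W w + cross_ip w W =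
  L2norm Omega w.2 ^+ 2 - gradnorm Omega w.1 ^+ 2 -
  gradnorm Omega w.2 ^+ 2 * gradip Omega w.2 w.1.
Proof.
case: w_dom => -[h1 w1] [h2' w2]; have [w11 _] := w1; have [[w22 _] _] := w2.
rewrite /cross_ip (L2ip_wave_op2 w1) (_ : W.1 = w.2); last by rewrite /W /= opprK.
by rewrite (L2norm_sqr w22) (gradnorm_sqr Omega_open Omega_bounded w11) addrA.
Qed.

End rates.

End energy_space.

(** * Decay along a trajectory *)

Lemma half_lipschitz (R : realType) (M x y z : R) :
  x <= 1 * y * z -> y <= M + M -> 0 <= z -> 2^-1 * x <= M * z.
Proof.
move=> h1 h2 z0; have : y * z <= (M + M) * z by rewrite ler_wpM2r.
lra.
Qed.

Lemma is_derive_weighted (R : realType) (e G : R -> R) (K r de dG : R) :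
  is_derive r (1 : R) e de -> is_derive r (1 : R) G dG ->
  is_derive r (1 : R) (fun s => (1 + s) ^+ 2 * e s + 3 * (1 + s) * G s - K * s)
    (2 * (1 + r) * e r + (1 + r) ^+ 2 * de + (3 * G r + 3 * (1 + r) * dG) - K).
Proof.
move=> he hG.
have d1 : is_derive r (1 : R) (fun s : R => 1 + s) 1.
  have -> : (fun s : R => 1 + s) = shift 1 by apply/funext => s; rewrite /shift addrC.
  exact: is_derive_shift.
have d2 := is_deriveM (is_deriveM d1 d1) he.
have d3 := is_deriveZ 3 (is_deriveM d1 hG).
have d4 := is_deriveZ K (is_derive_id r (1 : R)).
have d5 := is_deriveB (is_deriveD d2 d3) d4.
have -> : (fun s => (1 + s) ^+ 2 * e s + 3 * (1 + s) * G s - K * s) =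
  ((fun s => 1 + s) * (fun s => 1 + s) * e + 3 *: ((fun s => 1 + s) * G) - K *: id).
  apply/funext => s.
  rewrite -[RHS]/((1 + s) * (1 + s) * e s + 3 * ((1 + s) * G s) - K * s).
  by rewrite expr2 mulrA.
apply: (is_derive_eq d5).
rewrite -[LHS]/((1 + r) * (1 + r) * de +
  e r * ((1 + r) * 1 + (1 + r) * 1) + 3 * ((1 + r) * dG + G r * 1) - K * 1).
ring.
Qed.

Lemma half_sum_le (R : realType) (p q E0 : R) :
  0 <= q -> 2^-1 * (p + q) <= E0 -> p <= 2 * E0.
Proof. lra. Qed.

Lemma sqr_le_mul (R : realType) (c x a : R) : 0 <= c -> 0 <= x -> 0 <= a ->
  x <= c * a -> x ^+ 2 <= (2 * c) ^+ 2 * a ^+ 2.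
Proof.
move=> c0 x0 a0 h; rewrite -exprMn ler_pXn2r ?nnegrE ?mulr_ge0//.
by apply: (le_trans h); rewrite ler_wpM2r// ler_peMl// ler1n.
Qed.

Lemma early_decay (R : realType) (c E0 K e t : R) : 0 <= K -> 0 <= E0 -> 0 <= c ->
  0 <= t -> t <= 1 -> e <= E0 ->
  e * (1 + t) <= 4 * E0 + 9 * c * E0 + K + 1.
Proof.
move=> K0 E00 c0 t0 t1 eE.
have : e * (1 + t) <= E0 * (1 + t) by rewrite ler_wpM2r//; lra.
have : E0 * (1 + t) <= E0 * 2 by rewrite ler_wpM2l//; lra.
have : 0 <= c * E0 by rewrite mulr_ge0.
lra.
Qed.

Lemma late_decay (R : realType) (c E0 K e1 g1 e g t : R) : 0 <= K -> 0 <= E0 ->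
  0 <= c -> 1 <= t -> e1 <= E0 -> `|g1| <= c * E0 -> `|g| <= c * E0 ->
  (1 + t) ^+ 2 * e + 3 * (1 + t) * g - K * t <=
    (1 + 1) ^+ 2 * e1 + 3 * (1 + 1) * g1 - K * 1 ->
  e * (1 + t) <= 4 * E0 + 9 * c * E0 + K + 1.
Proof.
move=> K0 E00 c0 t1 e1E; rewrite !ler_norml => /andP[_ g1E] /andP[gE _] h.
have t0 : 0 < 1 + t by lra.
rewrite -(ler_pM2r t0).
have h1 : - (c * E0) * (1 + t) <= g * (1 + t) by rewrite ler_wpM2r// ltW.
have cE : 0 <= c * E0 by rewrite mulr_ge0.
have h2 : 0 <= c * E0 * t by rewrite mulr_ge0//; lra.
have h3 : 0 <= E0 * t by rewrite mulr_ge0//; lra.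
have h4 : (1 + 1) ^+ 2 * e1 <= 4 * E0.
  have -> : (1 + 1 : R) ^+ 2 = 4 by ring.
  by rewrite ler_wpM2l.
have h5 : e * (1 + t) * (1 + t) = (1 + t) ^+ 2 * e by ring.
have h6 : 3 * (1 + t) * g = 3 * (g * (1 + t)) by ring.
rewrite h5; rewrite h6 in h; lra.
Qed.

Section evolution.
Context {R : realType} {n : nat} (Omega : set 'rV[R]_n).
Hypotheses (Omega_open : open Omega) (Omega_bounded : bounded_set Omega).
Local Notation state := (('rV[R]_n -> R) * ('rV[R]_n -> R))%type.
Local Notation N := (energy_norm Omega).
Variables (c : R).
Hypothesis c_ge0 : 0 <= c.
Hypothesis c_poincare :
  forall u, H10 Omega u -> L2norm Omega u <= c * gradnorm Omega u.

Variables (U : R -> state).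
Hypothesis U_dom : forall t : R, 0 <= t -> energy_space Omega (U t).
Hypothesis U_cont : continuous_nonneg Omega U.
Hypothesis U_ac : forall a b : R, 0 < a -> a <= b -> abs_continuous_on Omega a b U.

Let iE := semi_inner_energy Omega_open Omega_bounded.
Let sE := subspace_energy_space Omega_open Omega_bounded.

Let aeF := ae_filter_ringOfSetsType (@lebesgue_measure R).

Definition energy_at (t : R) : R := 2^-1 * energy_ip Omega (U t) (U t).
Definition cross_at (t : R) : R := cross_ip Omega (U t) (U t).

(** Continuity bounds the trajectory near each time; the interval is compact. *)
Lemma trajectory_bounded (b : R) : 0 <= b ->
  exists2 M, 0 <= M & forall s, 0 <= s -> s <= b -> N (U s) <= M.
Proof.
move=> b0.
suff [M HM] : exists M, forall s, 0 <= s -> s <= b -> N (U s) <= M.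
  by exists M => //; apply: le_trans (HM 0 (lexx _) b0); exact: energy_norm_ge0.
pose P z := exists M, forall s, 0 <= s -> s <= z -> N (U s) <= M.
apply: (@cousin_induction _ P 0 b b0).
  by exists (N (U 0)) => s s0 s0'; have -> : s = 0 by apply/eqP; rewrite eq_le s0 s0'.
move=> x /andP[x0 _].
have /cvgrPdist_lt/(_ 1 ltr01) := U_cont x0.
rewrite near_withinE => -[d /= d0 Hd]; exists d => // s t s0 sx xt _ xsd txd [M HM].
exists (Num.max M (N (U x) + 1)) => z z0 zt; rewrite le_max.
have [zs|sz] := leP z s; first by rewrite HM.
apply/orP; right.
have := Hd z; rewrite /ball_ /= => /(_ _ z0)/wrap[|].
  by rewrite ltr_norml; apply/andP; split; lra.
rewrite sub0r normrN ger0_norm ?energy_norm_ge0// => Nz.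
have Uz := U_dom z0; have Ux := U_dom x0.
have := energy_norm_triangle Omega_open Omega_bounded (subspaceB sE Uz Ux) Ux.
rewrite subrK => /le_trans; apply.
by rewrite addrC lerD2l ltW.
Qed.

Lemma nonincreasing_of_rate (F : R -> R) (K a b : R) : 0 < a -> a <= b -> 0 <= K ->
  (forall s t, a <= s -> s <= t -> t <= b ->
    F t - F s <= K * (N (U t - U s) + (t - s))) ->
  {ae @lebesgue_measure R, forall t : R, a <= t <= b ->
     exists2 l, l <= 0 & is_derive t (1 : R) F l} ->
  F b <= F a.
Proof.
move=> a0 ab K0 FK; apply: (ac_nonincreasing ab _ FK) => e e0.
have K1 : 0 < 2 * (K + 1) by lra.
have [d d0 Hd] := U_ac a0 ab (divr_gt0 e0 K1).
exists (Num.min d (e / (2 * (K + 1)))); first by rewrite lt_min d0 divr_gt0.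
move=> m s t st disj; rewrite lt_min => /andP[sd se].
have := Hd m s t st disj sd; rewrite -mulr_sumr big_split /=.
move: se; set y := \sum_(k < m) (t k - s k).
set x := \sum_(k < m) N (U (t k) - U (s k)); clearbody x y.
rewrite !ltr_pdivlMr// => hy hx.
have [xy0|xy0] := leP (x + y) 0.
  by apply: le_lt_trans e0; rewrite mulr_ge0_le0.
lra.
Qed.

Lemma energy_at_lipschitz (M s t : R) : 0 <= s -> 0 <= t ->
  N (U s) <= M -> N (U t) <= M ->
  `|energy_at t - energy_at s| <= M * N (U t - U s).
Proof.
move=> s0 t0 sM tM; have Us := U_dom s0; have Ut := U_dom t0.
have h := bilinear_quadratic_lipschitz (sip_bilinear iE)
  (energy_ip_le Omega_open Omega_bounded) Ut Us.
rewrite /energy_at -mulrBr normrM ger0_norm ?invr_ge0//.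
exact: (half_lipschitz h (lerD tM sM) (energy_norm_ge0 _ _)).
Qed.

Lemma cross_at_lipschitz (M s t : R) : 0 <= s -> 0 <= t ->
  N (U s) <= M -> N (U t) <= M ->
  `|cross_at t - cross_at s| <= 2 * c * M * N (U t - U s).
Proof.
move=> s0 t0 sM tM; have Us := U_dom s0; have Ut := U_dom t0.
have h := bilinear_quadratic_lipschitz (bilinear_cross Omega_open Omega_bounded)
  (cross_ip_le c_ge0 c_poincare) Ut Us.
apply: (le_trans h); apply: ler_wpM2r; first exact: energy_norm_ge0.
have -> : 2 * c * M = c * (M + M) by ring.
by apply: ler_wpM2l => //; exact: lerD.
Qed.

Lemma energy_at_ge0 t : 0 <= t -> 0 <= energy_at t.
Proof. by move=> t0; rewrite mulr_ge0 ?invr_ge0// (sip_ge0 iE)//; exact: U_dom. Qed.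

Lemma energy_atE t : 0 <= t ->
  energy_at t = 2^-1 * (gradnorm Omega (U t).1 ^+ 2 + L2norm Omega (U t).2 ^+ 2).
Proof. by move=> t0; have := energyE Omega_open Omega_bounded (U_dom t0). Qed.

Lemma energy_norm_sqr t : 0 <= t -> N (U t) ^+ 2 = 2 * energy_at t.
Proof.
move=> t0; have Ut := U_dom t0.
rewrite (energy_normE Omega_open Omega_bounded Ut) sqr_sqrtr.
  by rewrite /energy_at mulrA divff ?mul1r// pnatr_eq0.
exact: (sip_ge0 iE).
Qed.

Lemma cross_at_le t : 0 <= t -> `|cross_at t| <= 2 * c * energy_at t.
Proof.
move=> t0; have Ut := U_dom t0.
apply: (le_trans (cross_ip_le c_ge0 c_poincare Ut Ut)).
by rewrite -expr2 energy_norm_sqr// mulrCA mulrA.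
Qed.

Hypothesis U_eq : {ae @lebesgue_measure R, forall t : R, 0 < t ->
  wave_domain Omega (U t) /\ has_derivative_at Omega U t (- wave_op Omega (U t))}.

Lemma is_derive_energy_cross t : 0 < t -> wave_domain Omega (U t) ->
  has_derivative_at Omega U t (- wave_op Omega (U t)) ->
  is_derive t (1 : R) energy_at
    (- (gradnorm Omega (U t).2 ^+ 2 * gradnorm Omega (U t).2 ^+ 2)) /\
  is_derive t (1 : R) cross_at
    (L2norm Omega (U t).2 ^+ 2 - gradnorm Omega (U t).1 ^+ 2 -
     gradnorm Omega (U t).2 ^+ 2 * gradip Omega (U t).2 (U t).1).
Proof.
move=> t0 Ud Uder.
have near0 : \forall h \near (0 : R), energy_space Omega (U (t + h)).
  exists t => //= h; rewrite /ball_ /= sub0r normrN => ht.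
  by apply: U_dom; have := ler_norm (- h); rewrite normrN; lra.
have hW := wave_op_energy_space Omega_open Omega_bounded Ud.
split.
  have d := is_derive_bilinear (sip_bilinear iE) ler01
    (fun w _ => energy_norm_ge0 Omega w) (energy_ip_le Omega_open Omega_bounded)
    near0 hW Uder.
  rewrite (energy_rate Omega_open Omega_bounded Ud) in d.
  have n2 : (2 : R) != 0 by rewrite pnatr_eq0.
  have dZ := is_deriveZ (2^-1) d.
  by apply: (is_derive_eq dZ); exact: (mulKf n2).
have d := is_derive_bilinear (bilinear_cross Omega_open Omega_bounded) c_ge0
  (fun w _ => energy_norm_ge0 Omega w) (cross_ip_le c_ge0 c_poincare)
  near0 hW Uder.
by rewrite (cross_rate Omega_open Omega_bounded Ud) in d.
Qed.

Lemma energy_at_nonincreasing a b : 0 < a -> a <= b -> energy_at b <= energy_at a.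
Proof.
move=> a0 ab; have b0 : 0 <= b by lra.
have [M M0 HM] := trajectory_bounded b0.
apply: (nonincreasing_of_rate a0 ab M0).
  move=> s t as_ st tb; have s0 : 0 <= s by lra.
  have t0 : 0 <= t by lra.
  have sb : s <= b by lra.
  apply: (le_trans (ler_norm _)).
  apply: (le_trans (energy_at_lipschitz s0 t0 (HM s s0 sb) (HM t t0 tb))).
  by apply: ler_wpM2l => //; rewrite lerDl; lra.
apply: (@filterS _ _ aeF _ _ _ U_eq) => t Ht /andP[at_ tb].
have t0 : 0 < t by lra.
have [Ud Uder] := Ht t0.
have [dE _] := is_derive_energy_cross t0 Ud Uder.
eexists; last exact: dE.
by rewrite oppr_le0 mulr_ge0 ?sqr_ge0.
Qed.

(** Times in [0, 1] are treated separately, since the trajectory is absolutely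
    continuous only away from 0; there boundedness is enough, and from time 1 on
    Phi is nonincreasing. *)
Lemma energy_at_decay : exists2 C : R, 0 < C &
  forall t, 0 <= t -> energy_at t <= C / (1 + t).
Proof.
have [E0 E00 early] : exists2 E0, 0 <= E0 &
    forall t, 0 <= t -> t <= 1 -> energy_at t <= E0.
  have [M M0 HM] := trajectory_bounded ler01.
  exists (2^-1 * M ^+ 2); first by rewrite mulr_ge0 ?invr_ge0 ?sqr_ge0.
  move=> t t0 t1; have : N (U t) ^+ 2 <= M ^+ 2.
    by rewrite ler_pXn2r// ?nnegrE// ?energy_norm_ge0// HM.
  rewrite energy_norm_sqr//; move: (energy_at t) (M ^+ 2) => x y; lra.
have bound t : 0 <= t -> energy_at t <= E0.
  move=> t0; have [t1|t1] := leP t 1; first exact: early.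
  apply: (le_trans (energy_at_nonincreasing ltr01 (ltW t1))).
  exact: early.
(* The constant of Young's inequality: c bounds || u_t || by c a, while
   |G| <= 2 c E. *)
have [c2 c2E] : exists c2, c2 = 2 * c by exists (2 * c).
have c20 : 0 <= c2 by rewrite c2E mulr_ge0.
have cross t : 0 <= t -> `|cross_at t| <= c2 * E0.
  move=> t0; apply: (le_trans (cross_at_le t0)).
  by rewrite c2E; apply: ler_wpM2l; [rewrite mulr_ge0|exact: bound].
have cE : 0 <= c2 * E0 by rewrite mulr_ge0.
have [K KE] : exists K, K = 16 * c2 ^+ 4 + 324 * E0 ^+ 2 + 3 * c2 * E0.
  by eexists.
have K0 : 0 <= K.
  rewrite KE -mulrA; have := sqr_ge0 E0; have := exprn_ge0 4 c20; lra.
pose Phi t := (1 + t) ^+ 2 * energy_at t + 3 * (1 + t) * cross_at t - K * t.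
have Phi_mono t : 1 <= t -> Phi t <= Phi 1.
  move=> t1; have t0 : 0 <= t by lra.
  have [M M0 HM] := trajectory_bounded t0.
  pose K1 := (1 + t) ^+ 2 * M + 6 * (1 + t) * c2 * M + 2 * (1 + t) * E0 +
    3 * c2 * E0 + K.
  have tp : 0 <= 1 + t by rewrite addr_ge0.
  have h1 : 0 <= (1 + t) ^+ 2 * M by rewrite mulr_ge0 ?sqr_ge0.
  have h2 : 0 <= (1 + t) * c2 * M by rewrite !mulr_ge0.
  have h3 : 0 <= (1 + t) * E0 by rewrite mulr_ge0.
  have K10 : 0 <= K1 by rewrite /K1; lra.
  apply: (nonincreasing_of_rate (K := K1) ltr01 t1 K10).
    move=> s r s1 sr rt; have s0 : 0 <= s by lra.
    have r0 : 0 <= r by lra.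
    have st : s <= t by lra.
    apply: weighted_energy_lipschitz => //.
    - by lra.
    - exact: energy_norm_ge0.
    - by rewrite ger0_norm ?energy_at_ge0// bound.
    - exact: cross.
    - exact: energy_at_lipschitz (HM s s0 st) (HM r r0 rt).
    - apply: (le_trans (cross_at_lipschitz s0 r0 (HM s s0 st) (HM r r0 rt))).
      apply: ler_wpM2r; first exact: energy_norm_ge0.
      by apply: ler_wpM2r => //; rewrite c2E ler_peMl ?mulr_ge0// ler1n.
  apply: (@filterS _ _ aeF _ _ _ U_eq) => r Hr /andP[r1 rt].
  have r0 : 0 < r by lra.
  have [Ud Uder] := Hr r0.
  have [dE dG] := is_derive_energy_cross r0 Ud Uder.
  exists (2 * (1 + r) * energy_at r + (1 + r) ^+ 2 *
    - (gradnorm Omega (U r).2 ^+ 2 * gradnorm Omega (U r).2 ^+ 2) +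
    (3 * cross_at r + 3 * (1 + r) *
      (L2norm Omega (U r).2 ^+ 2 - gradnorm Omega (U r).1 ^+ 2 -
       gradnorm Omega (U r).2 ^+ 2 * gradip Omega (U r).2 (U r).1)) - K).
    have r0' := ltW r0; have [_ [_ v10]] := Ud; have [v1 _] := v10.
    have [[u1 _] _] := U_dom r0'.
    have Er := energy_atE r0'.
    have Eb := bound r r0'; rewrite Er in Eb.
    rewrite KE Er; apply: (@decay_rate_le0 _ c2 E0 (1 + r) (gradnorm Omega (U r).2)
      (gradnorm Omega (U r).1 ^+ 2) (L2norm Omega (U r).2 ^+ 2) (gradnorm Omega (U r).1)).
    - exact: c20.
    - by rewrite lerDl.
    - exact: sqrtr_ge0.
    - exact: sqrtr_ge0.
    - by [].
    - exact: sqr_ge0.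
    - exact: (half_sum_le (sqr_ge0 _) Eb).
    - rewrite c2E.
      exact: (sqr_le_mul c_ge0 (L2norm_ge0 _ _) (sqrtr_ge0 _) (c_poincare v10)).
    - exact: (le_trans (ler_norm _) (cross r r0')).
    - have := grad_cauchy_schwarz Omega_open Omega_bounded v1 u1.
      by rewrite ler_norml => /andP[+ _]; rewrite lerNl.
  exact: is_derive_weighted.
exists (4 * E0 + 9 * c2 * E0 + K + 1).
  lra.
move=> t t0; have Et := bound t t0.
rewrite ler_pdivlMr; last by lra.
have [t1|t1] := leP t 1; first exact: early_decay.
exact: (late_decay K0 E00 c20 (ltW t1) (early 1 ler01 (lexx 1)) (cross 1 ler01)
  (cross t t0) (Phi_mono t (ltW t1))).
Qed.

End evolution.

Theorem theorem6p2 (R : realType) (n : nat) (n_gt0 : (0 < n)%N)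
    (Omega : set 'rV[R]_n) (Omega_domain : bounded_domain Omega)
    (Omega_smooth : smooth_boundary Omega)
    (u0 u1 : 'rV[R]_n -> R) (u01_H : energy_space Omega (u0, u1))
    (U : R -> ('rV[R]_n -> R) * ('rV[R]_n -> R))
    (U_sol : strong_solution Omega u0 u1 U) :
  exists2 C : R, 0 < C &
    forall t : R, 0 <= t -> energy Omega (U t) <= C / (1 + t).
Proof.
have [_ Omega_open _ Omega_bounded] := Omega_domain.
have [U_dom U_cont _ U_ac U_eq] := U_sol.
have [c c0 cP] := poincare Omega_open Omega_bounded (Ordinal n_gt0).
have [C C0 HC] := energy_at_decay Omega_open Omega_bounded c0 cP U_dom U_cont U_ac U_eq.
exists C => // t t0; rewrite (energyE Omega_open Omega_bounded (U_dom t t0)).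
exact: HC.
Qed.
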